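(* Let $X$ be a real $C^\infty$ manifold, let $m$ be a nonnegative integer and let $r$ be a nonnegative integer or $r=\infty$. For any $m-r\in\mathbb{Z}\cup\{-\infty\}$, the natural morphism of sheaves on $X$ $$\mathcal{D}^{m-r,r}_X\longrightarrow \mathcal{H}om_{\mathbb{R}_X}(\mathcal{C}^m_X,\mathcal{C}^r_X),\qquad P\longmapsto(\varphi\longmapsto P(\varphi)),$$ is an isomorphism. Here, by convention, $\mathcal{D}^{m-r,r}_X=0$ when $m-r<0$, so that in this case the assertion is that $\mathcal{H}om_{\mathbb{R}_X}(\mathcal{C}^m_X,\mathcal{C}^r_X)=0$.
   Context: For $0\le k\le\infty$, $\mathcal{C}^k_X$ denotes the sheaf on $X$ of real-valued functions of class $C^k$ (for $k=0$, continuous functions). $\mathbb{R}_X$ is the constant sheaf with stalk $\mathbb{R}$, and $\mathcal{H}om_{\mathbb{R}_X}(\mathcal{F},\mathcal{G})$ is the sheaf whose sections over an open set $U\subseteq X$ are the $\mathbb{R}$-linear morphisms of sheaves $\mathcal{F}|_U\to\mathcal{G}|_U$. For integers $0\le k<\infty$ and $0\le r<\infty$, $\mathcal{D}^{k,r}_X$ denotes the sheaf of differential operators of order $\le k$ with coefficients of class $C^r$: a section $P$ can be written locally, in a local chart with coordinates $(x_1,\ldots,x_n)$, $n=\dim X$, as $P=\sum_{|\alpha|\le k}a_\alpha(x)\partial^\alpha$ with $a_\alpha$ real-valued functions of class $C^r$, where $\alpha=(\alpha_1,\ldots,\alpha_n)$ is a multi-index, $|\alpha|=\sum_i\alpha_i$,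 $\partial_i=\partial/\partial x_i$ and $\partial^\alpha=\partial_1^{\alpha_1}\cdots\partial_n^{\alpha_n}$. In particular $\mathcal{D}^{0,r}_X=\mathcal{C}^r_X$. If $m-r<0$ (including $m-r=-\infty$, i.e. $r=\infty$), one sets $\mathcal{D}^{m-r,r}_X=0$.
   Formalization: When m−r<0 (including r=∞) the manifold X is assumed to have positive dimension, since on a point C^m and C^r are both ℝ and Hom(ℝ,ℝ)=ℝ is not 0; dimension 0 is kept when m−r≥0. *)

(* Defs.v *)
From HB Require Import structures.
From mathcomp Require Import all_boot all_order all_algebra.
From mathcomp Require Import all_classical all_reals all_analysis.
Set Implicit Arguments.
Unset Strict Implicit.
Unset Printing Implicit Defensive.
Import Order.TTheory GRing.Theory Num.Theory.
Import numFieldNormedType.Exports.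
Local Open Scope classical_set_scope.
Local Open Scope ring_scope.

Section Sheaves.
Context {R : realType} {X : topologicalType}.

Record opens := Opens { oset :> set X; oset_open : open oset }.

Lemma openI_opens (U V : opens) : open ((U : set X) `&` V).
Proof. by apply: openI; apply: oset_open. Qed.
Definition opensI (U V : opens) := Opens (openI_opens U V).

(* Sheaves of R-vector spaces. Compatibility on overlaps is asked on every open
   subset of V i `&` V j, which amounts to asking it on V i `&` V j itself. *)
Record sheaf := Sheaf {
  sect :> opens -> lmodType R;
  res : forall U V : opens, V `<=` U -> sect U -> sect V;
  res_linear : forall (U V : opens) (h : V `<=` U), linear (res h);
  res_id : forall (U : opens) (h : U `<=` U) s, res h s = s;
  res_comp : forall (U V W : opens) (hVU : V `<=` U) (hWV : W `<=` V)
    (hWU : W `<=` U) s, res hWV (res hVU s) = res hWU s;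
  sheaf_glue : forall (U : opens) (I : Type) (V : I -> opens)
    (hV : forall i, V i `<=` U), U `<=` \bigcup_i V i ->
    forall s : (forall i, sect (V i)),
    (forall i j (W : opens) (hi : W `<=` V i) (hj : W `<=` V j),
       res hi (s i) = res hj (s j)) ->
    exists! t : sect U, forall i, res (hV i) t = s i }.

Lemma res0 (F : sheaf) (U V : opens) (h : V `<=` U) : res h (0 : F U) = 0.
Proof.
have := @res_linear F _ _ h (-1) 0 0.
by rewrite scaler0 addr0 => ->; rewrite scaleN1r addNr.
Qed.

Lemma sheaf_sep (F : sheaf) (U : opens) (I : Type) (V : I -> opens)
    (hV : forall i, V i `<=` U) (t t' : F U) : U `<=` \bigcup_i V i ->
  (forall i, res (hV i) t = res (hV i) t') -> t = t'.
Proof.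
move=> cov tt'; have [|u [_ uP]] := sheaf_glue hV cov (s := fun i => res (hV i) t').
  move=> i j W hi hj.
  have hW : W `<=` U by move=> x /hi; exact: hV.
  by rewrite (res_comp _ _ hW) (res_comp _ _ hW).
by rewrite -(uP t) // -(uP t').
Qed.

Record sheaf_hom (F G : sheaf) := SheafHom {
  shom :> forall U : opens, F U -> G U;
  shom_linear : forall U, linear (@shom U);
  shom_res : forall (U V : opens) (h : V `<=` U) (s : F U),
    shom (res h s) = res h (shom s) }.

Definition sheaf_iso (F G : sheaf) (f : sheaf_hom F G) : Prop :=
  exists g : sheaf_hom G F,
    (forall U (s : F U), g U (f U s) = s) /\
    (forall U (t : G U), f U (g U t) = t).

Lemma zero_sheaf_glue (U : opens) (I : Type) (V : I -> opens)
    (hV : forall i, V i `<=` U) : U `<=` \bigcup_i V i ->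
  forall s : (forall i, 'rV[R]_0),
  (forall i j (W : opens) (hi : W `<=` V i) (hj : W `<=` V j),
     id (s i) = id (s j)) ->
  exists! t : 'rV[R]_0, forall i, id t = s i.
Proof.
by move=> _ s _; exists 0; split=> [i|t _]; apply/rowP => -[].
Qed.

Definition zero_sheaf := @Sheaf (fun=> 'rV[R]_0 : lmodType R)
  (fun _ _ _ => id) (fun _ _ _ _ _ _ => erefl) (fun _ _ _ => erefl)
  (fun _ _ _ _ _ _ _ => erefl) zero_sheaf_glue.

Program Definition zero_hom (G : sheaf) : sheaf_hom zero_sheaf G :=
  @SheafHom zero_sheaf G (fun _ _ => 0) _ _.
Next Obligation. by move=> G U a s t; rewrite scaler0 addr0. Qed.
Next Obligation. by move=> G U V h s; rewrite res0. Qed.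

Section SheafHom.
Variables F G : sheaf.

(* R-linear morphisms of sheaves from F|_U to G|_U. *)
Record hom_sec (U : opens) := HomSec {
  hmap :> forall V : opens, V `<=` U -> F V -> G V;
  hmap_linear : forall (V : opens) (h : V `<=` U), linear (hmap h);
  hmap_res : forall (V W : opens) (hVU : V `<=` U) (hWU : W `<=` U)
    (hWV : W `<=` V) (s : F V), hmap hWU (res hWV s) = res hWV (hmap hVU s) }.

HB.instance Definition _ U := gen_eqMixin (hom_sec U).
HB.instance Definition _ U := gen_choiceMixin (hom_sec U).

Lemma hom_secP U (S T : hom_sec U) :
  (forall (V : opens) (h : V `<=` U) s, S V h s = T V h s) -> S = T.
Proof.
case: S T => [S Sl Sr] [T Tl Tr] /= ST.
have {}ST : S = T.
  apply: functional_extensionality_dep => V.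
  apply: functional_extensionality_dep => h.
  by apply/funext => s; exact: ST.
by subst T; congr HomSec; exact: Prop_irrelevance.
Qed.

Section Ops.
Variables (U : opens).

Program Definition hom_zero := @HomSec U (fun _ _ _ => 0) _ _.
Next Obligation. by move=> V h a s t; rewrite scaler0 addr0. Qed.
Next Obligation.
by move=> V W hVU hWU hWV s /=; rewrite res0.
Qed.

Program Definition hom_lin (a : R) (S T : hom_sec U) :=
  @HomSec U (fun V h s => a *: S V h s + T V h s) _ _.
Next Obligation.
move=> a S T V h b s t; rewrite !hmap_linear !scalerDr !scalerA (mulrC a).
by rewrite -!addrA; congr (_ + _); rewrite addrCA.
Qed.
Next Obligation.
by move=> a S T V W hVU hWU hWV s /=; rewrite !(hmap_res _ hVU) res_linear.
Qed.

Definition hom_add (S T : hom_sec U) := hom_lin 1 S T.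
Definition hom_scale a (S : hom_sec U) := hom_lin a S hom_zero.
Definition hom_opp (S : hom_sec U) := hom_scale (-1) S.

Let addE := (scale1r, addr0, scaleN1r).
Lemma hom_addA : associative hom_add.
Proof. by move=> S T Q; apply: hom_secP => V h s /=; rewrite !addE addrA. Qed.
Lemma hom_addC : commutative hom_add.
Proof. by move=> S T; apply: hom_secP => V h s /=; rewrite !addE addrC. Qed.
Lemma hom_add0 : left_id hom_zero hom_add.
Proof. by move=> S; apply: hom_secP => V h s /=; rewrite !addE add0r. Qed.
Lemma hom_addN : left_inverse hom_zero hom_opp hom_add.
Proof. by move=> S; apply: hom_secP => V h s /=; rewrite !addE addNr. Qed.
HB.instance Definition _ :=
  GRing.isZmodule.Build (hom_sec U) hom_addA hom_addC hom_add0 hom_addN.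

Lemma hom_scaleA a b S : hom_scale a (hom_scale b S) = hom_scale (a * b) S.
Proof. by apply: hom_secP => V h s /=; rewrite !addE scalerA. Qed.
Lemma hom_scale1 : left_id 1 hom_scale.
Proof. by move=> S; apply: hom_secP => V h s /=; rewrite !addE. Qed.
Lemma hom_scaleDr : right_distributive hom_scale +%R.
Proof. by move=> a S T; apply: hom_secP => V h s /=; rewrite !addE scalerDr. Qed.
Lemma hom_scaleDl S : {morph hom_scale^~ S : a b / a + b}.
Proof. by move=> a b; apply: hom_secP => V h s /=; rewrite !addE scalerDl. Qed.
HB.instance Definition _ := GRing.Zmodule_isLmodule.Build R (hom_sec U)
  hom_scaleA hom_scale1 hom_scaleDr hom_scaleDl.

Lemma hom_linE a (S T : hom_sec U) (V : opens) (h : V `<=` U) s :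
  (a *: S + T) V h s = a *: S V h s + T V h s.
Proof. by rewrite /= !addE. Qed.
End Ops.

Program Definition hom_restr (U V : opens) (h : V `<=` U) (T : hom_sec U) :=
  @HomSec V (fun W hW s => T W (subset_trans hW h) s) _ _.
Next Obligation. by move=> U V h T W hW; exact: hmap_linear. Qed.
Next Obligation. by move=> U V h T W Z hW hZ hZW s; exact: hmap_res. Qed.

Lemma hom_restr_linear (U V : opens) (h : V `<=` U) : linear (hom_restr h).
Proof. by move=> a S T; apply: hom_secP => W hW s; rewrite hom_linE; exact: hom_linE. Qed.

Lemma hmap_irr (U : opens) (T : hom_sec U) (V : opens) (h h' : V `<=` U) s : T V h s = T V h' s.
Proof. by rewrite (Prop_irrelevance h h'). Qed.

Lemma hom_restr_id (U : opens) (h : U `<=` U) T : hom_restr h T = T.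
Proof. by apply: hom_secP => V hV s /=; exact: hmap_irr. Qed.

Lemma hom_restr_comp (U V W : opens) (hVU : V `<=` U) (hWV : W `<=` V)
  (hWU : W `<=` U) T : hom_restr hWV (hom_restr hVU T) = hom_restr hWU T.
Proof. by apply: hom_secP => Z hZ s /=; exact: hmap_irr. Qed.

Section Glue.
Variables (U : opens) (I : Type) (V : I -> opens) (hV : forall i, V i `<=` U).
Hypothesis cov : U `<=` \bigcup_i V i.
Variable T : forall i, hom_sec (V i).
Hypothesis compat : forall i j (W : opens) (hi : W `<=` V i) (hj : W `<=` V j),
  hom_restr hi (T i) = hom_restr hj (T j).

Let subl (W : opens) i : opensI W (V i) `<=` W := fun x => @proj1 _ _.
Let subr (W : opens) i : opensI W (V i) `<=` V i := fun x => @proj2 _ _.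

Lemma compatE i j (W : opens) (hi : W `<=` V i) (hj : W `<=` V j) s :
  T i W hi s = T j W hj s.
Proof.
have /(congr1 (fun S : hom_sec W => S W (fun _ => id) s)) /= := compat hi hj.
by rewrite (hmap_irr _ _ hi) (hmap_irr _ _ hj).
Qed.

Lemma covW (W : opens) : W `<=` U -> W `<=` \bigcup_i opensI W (V i).
Proof. by move=> hW x Wx; have [i _ Vx] := cov (hW _ Wx); exists i. Qed.

Lemma glue_at (W : opens) (hW : W `<=` U) (s : F W) :
  {t : G W | forall i, res (@subl W i) t = T i _ (@subr W i) (res (@subl W i) s)}.
Proof.
apply: cid.
have [|t [tP _]] := sheaf_glue (@subl W) (covW hW)
    (s := fun i => T i _ (@subr W i) (res (@subl W i) s)); last by exists t.
move=> i j Z hi hj.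
have hZi : Z `<=` V i by move=> x /hi [].
have hZj : Z `<=` V j by move=> x /hj [].
have hZW : Z `<=` W by move=> x /hi [].
rewrite -(hmap_res _ _ hZi) -(hmap_res _ _ hZj).
by rewrite !(res_comp _ _ hZW); exact: compatE.
Qed.

Program Definition glued :=
  @HomSec U (fun W hW s => sval (glue_at hW s)) _ _.
Next Obligation.
move=> W hW a s t; apply: (sheaf_sep (hV := @subl W) (covW hW)) => i.
rewrite res_linear; case: glue_at => x -> /=; case: glue_at => y -> /=.
by case: glue_at => z -> /=; rewrite -hmap_linear -res_linear.
Qed.
Next Obligation.
move=> W Z hW hZ hZW s; apply: (sheaf_sep (hV := @subl Z) (covW hZ)) => i.
case: glue_at => x -> /=; case: glue_at => y yP /=.
have h1 : opensI Z (V i) `<=` W by move=> z [/hZW].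
have h2 : opensI Z (V i) `<=` opensI W (V i) by move=> z [/hZW].
rewrite !(res_comp _ _ h1) -(res_comp (@subl W i) h2 h1 y) yP.
by rewrite -(hmap_res _ _ (@subr Z i)) (res_comp _ _ h1).
Qed.

Lemma hom_glue : exists! S : hom_sec U, forall i, hom_restr (@hV i) S = T i.
Proof.
exists glued; split=> [i|S SP].
  apply: hom_secP => W hW s /=.
  apply: (sheaf_sep (hV := @subl W) (covW (subset_trans hW (@hV i)))) => j.
  case: glue_at => x -> /=; rewrite -(hmap_res _ _ (subset_trans (@subl W j) hW)).
  exact: compatE.
apply: hom_secP => W hW s; apply: (sheaf_sep (hV := @subl W) (covW hW)) => i.
rewrite /glued /=; case: glue_at => x -> /=.
rewrite -SP /= -(hmap_res _ _ (subset_trans (@subl W i) hW)).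
exact: hmap_irr.
Qed.
End Glue.

Definition Hom := @Sheaf hom_sec hom_restr hom_restr_linear hom_restr_id
  hom_restr_comp hom_glue.
End SheafHom.

End Sheaves.
Arguments opens X : clear implicits.
Arguments sheaf R X : clear implicits.
Arguments zero_sheaf R X : clear implicits.

Variant regularity := Cfin of nat | Cinf.

Section Calculus.
Context {R : realType} {n : nat}.
Implicit Types (W : set 'rV[R]_n) (f g : 'rV[R]_n -> R).

Definition partial (i : 'I_n) f : 'rV[R]_n -> R :=
  fun y => 'D_(delta_mx 0 i) f y.

(* The values of f outside of the open set W are irrelevant. *)
Fixpoint Cnat (k : nat) W f : Prop :=
  match k with
  | 0 => forall y, W y -> {for y, continuous f}
  | k'.+1 => (forall y, W y -> {for y, continuous f}) /\
      forall i, (forall y, W y -> derivable f y (delta_mx 0 i)) /\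
        Cnat k' W (partial i f)
  end.

Definition Creg (r : regularity) W f : Prop :=
  match r with Cfin k => Cnat k W f | Cinf => forall k, Cnat k W f end.

Definition mdeg (alpha : 'I_n -> nat) : nat := (\sum_i alpha i)%N.

Definition pderiv (alpha : 'I_n -> nat) f : 'rV[R]_n -> R :=
  foldr (fun i g => iter (alpha i) (partial i) g) f (enum 'I_n).

Lemma Cnat_cont k W f : Cnat k W f -> forall y, W y -> {for y, continuous f}.
Proof. by case: k => [|k] // []. Qed.

Lemma Cnat_sub k W W' f : W' `<=` W -> Cnat k W f -> Cnat k W' f.
Proof.
move=> sW; elim: k f => [|k IH] f /=; first by move=> + y /sW; apply.
move=> [fc fd]; split=> [y /sW|i]; first exact: fc.
by have [fdi fci] := fd i; split=> [y /sW|]; [exact: fdi|exact: IH].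
Qed.

Lemma Cnat_pred k W f : Cnat k.+1 W f -> Cnat k W f.
Proof.
elim: k f => [|k IH] f; first by case.
move=> [fc fd]; split=> // i; have [fdi fci] := fd i.
by split=> //; exact: IH.
Qed.

Lemma Cnat_le k l W f : (k <= l)%N -> Cnat l W f -> Cnat k W f.
Proof.
move=> /subnK <-; elim: (l - k)%N => // d IH.
by rewrite addSn => /Cnat_pred.
Qed.

Lemma Cnat_local k W f :
  (forall y, W y -> exists2 W', W' y & Cnat k W' f) -> Cnat k W f.
Proof.
elim: k f => [|k IH] f /= fW.
  by move=> y Wy; have [W' W'y] := fW y Wy; apply.
split=> [y Wy|i]; first by have [W' W'y []] := fW y Wy; move=> + _; apply.
split=> [y Wy|].
  by have [W' W'y [_ /(_ i) []]] := fW y Wy; move=> + _; apply.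
apply: IH => y Wy; have [W' W'y [_ /(_ i) []]] := fW y Wy.
by move=> _ fi; exists W'.
Qed.

Lemma near_open W y f g : open W -> W y -> (forall z, W z -> f z = g z) ->
  \forall z \near y, f z = g z.
Proof. by move=> oW Wy fg; apply: filterS fg _; exact: open_nbhs_nbhs. Qed.

Lemma eq_partial W f g i : open W -> (forall y, W y -> f y = g y) ->
  forall y, W y -> partial i f y = partial i g y.
Proof.
by move=> oW fg y Wy; apply: near_eq_derive; exact: (near_open oW Wy fg).
Qed.

Lemma eq_pderiv W f g a : open W -> (forall y, W y -> f y = g y) ->
  forall y, W y -> pderiv a f y = pderiv a g y.
Proof.
move=> oW fg; rewrite /pderiv; elim: (enum _) => [|i s IH] //=.
elim: (a i) => [|k IHk] //=; exact: eq_partial.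
Qed.

Lemma eq_continuous_for W f g y : open W -> W y ->
  (forall z, W z -> f z = g z) -> {for y, continuous f} ->
  {for y, continuous g}.
Proof.
move=> oW Wy fg fc; rewrite /prop_for /continuous_at -(fg _ Wy).
apply: cvg_trans fc; apply: (@near_eq_cvg _ _ (nbhs y)).
exact: (near_open oW Wy fg).
Qed.

Lemma eq_Cnat k W f g : open W -> (forall y, W y -> f y = g y) ->
  Cnat k W f -> Cnat k W g.
Proof.
move=> oW; elim: k f g => [|k IH] f g fg /=.
  by move=> fc y Wy; exact: (eq_continuous_for oW Wy fg (fc _ Wy)).
move=> [fc fd]; split=> [y Wy|i].
  exact: (eq_continuous_for oW Wy fg (fc _ Wy)).
have [fdi fci] := fd i; split=> [y Wy|].
  exact: (near_eq_derivable (near_open oW Wy fg) (fdi _ Wy)).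
by apply: IH fci; exact: eq_partial.
Qed.

Lemma Cnat_cst k W (c : R) : open W -> Cnat k W (fun=> c).
Proof.
move=> oW; elim: k c => [|k IH] c /=; first by move=> y _; exact: cst_continuous.
split=> [y _|i]; first exact: cst_continuous.
split=> [y _|]; first exact: derivable_cst.
by apply: eq_Cnat (IH 0) => // y Wy; rewrite /partial derive_cst.
Qed.

Lemma Cnat_lin k W (c : R) f g : open W -> Cnat k W f -> Cnat k W g ->
  Cnat k W (fun y => c * f y + g y).
Proof.
move=> oW; elim: k f g => [|k IH] f g /=.
  move=> fc gc y Wy.
  exact: (cvgD (cvgM (cvg_cst c) (fc y Wy)) (gc y Wy)).
move=> [fc fd] [gc gd]; split=> [y Wy|i].
  exact: (cvgD (cvgM (cvg_cst c) (fc y Wy)) (gc y Wy)).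
have [fdi fci] := fd i; have [gdi gci] := gd i; split=> [y Wy|].
  exact: (derivableD (derivableZ (k := c) (fdi y Wy)) (gdi y Wy)).
apply: (eq_Cnat oW _ (IH _ _ fci gci)) => y Wy.
have dcf := derivableZ (k := c) (fdi y Wy).
have E := deriveD dcf (gdi y Wy).
by rewrite (deriveZ c (fdi y Wy)) in E; rewrite /partial -[LHS]E.
Qed.

Lemma Cnat_mul k W f g : open W -> Cnat k W f -> Cnat k W g ->
  Cnat k W (fun y => f y * g y).
Proof.
move=> oW; elim: k f g => [|k IH] f g.
  by move=> /= fc gc y Wy; exact: (cvgM (fc y Wy) (gc y Wy)).
move=> fC gC; have [fc fd] := fC; have [gc gd] := gC; split=> [y Wy|i].
  by exact: (cvgM (fc y Wy) (gc y Wy)).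
have [fdi fci] := fd i; have [gdi gci] := gd i; split=> [y Wy|].
  exact: (derivableM (fdi y Wy) (gdi y Wy)).
have fgi := IH _ _ (Cnat_pred fC) gci.
have gfi := IH _ _ (Cnat_pred gC) fci.
apply: (eq_Cnat oW _ (Cnat_lin 1 oW fgi gfi)) => y Wy.
by have E := deriveM (fdi y Wy) (gdi y Wy); rewrite mul1r -[LHS]E.
Qed.

Lemma Cnat_sum k W (I : Type) (s : seq I) (P : pred I)
    (f : I -> 'rV[R]_n -> R) : open W -> (forall i, P i -> Cnat k W (f i)) ->
  Cnat k W (fun y => \sum_(i <- s | P i) f i y).
Proof.
move=> oW fC; elim: s => [|i s IH].
  by apply: eq_Cnat (Cnat_cst k 0 oW) => // y _; rewrite big_nil.
have [Pi|Pi] := boolP (P i).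
  apply: (eq_Cnat oW _ (Cnat_lin 1 oW (fC _ Pi) IH)) => y _.
  by rewrite mul1r big_cons Pi.
by apply: eq_Cnat IH => // y _; rewrite big_cons (negbTE Pi).
Qed.

Lemma Cnat_pderiv k W f a : Cnat (k + mdeg a) W f -> Cnat k W (pderiv a f).
Proof.
rewrite /mdeg -big_enum /pderiv /=.
elim: (enum _) k => [|i s IH] k; first by rewrite big_nil addn0.
rewrite big_cons addnA => /IH /=.
elim: (a i) k => [|j IHj] k; first by rewrite addn0.
by rewrite addnS -addSn => /IHj [_ /(_ i) []].
Qed.

Lemma Creg_sub r W W' f : W' `<=` W -> Creg r W f -> Creg r W' f.
Proof. by case: r => [k|] sW /= fC => [|k]; exact: Cnat_sub (fC k)||exact: Cnat_sub fC. Qed.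

Lemma Creg_local r W f :
  (forall y, W y -> exists2 W', W' y & Creg r W' f) -> Creg r W f.
Proof.
case: r => [k|] /= fW => [|k]; apply: Cnat_local => //.
by move=> y Wy; have [W' W'y fC] := fW y Wy; exists W'.
Qed.

Lemma eq_Creg r W f g : open W -> (forall y, W y -> f y = g y) ->
  Creg r W f -> Creg r W g.
Proof.
by case: r => [k|] oW fg /= fC => [|k]; apply: eq_Cnat fg _ => //; exact: fC.
Qed.

Lemma Creg_cst r W (c : R) : open W -> Creg r W (fun=> c).
Proof. by case: r => [k|] oW => [|k]; exact: Cnat_cst. Qed.

Lemma Creg_lin r W (c : R) f g : open W -> Creg r W f -> Creg r W g ->
  Creg r W (fun y => c * f y + g y).
Proof.
by case: r => [k|] oW /= fC gC => [|k]; apply: Cnat_lin => //.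
Qed.

End Calculus.

(* An n-dimensional chart: a homeomorphism cmap from the open set cdom onto the
   open set cmap @` cdom, with inverse cinv. Both maps are total; their values
   outside of cdom and cmap @` cdom are irrelevant. *)
Record chart (R : realType) (n : nat) (X : topologicalType) := Chart {
  cdom : set X;
  cmap : X -> 'rV[R]_n;
  cinv : 'rV[R]_n -> X;
  cdom_open : open cdom;
  cimg_open : open (cmap @` cdom);
  cmapK : forall x, cdom x -> cinv (cmap x) = x;
  cmap_cont : forall x, cdom x -> {for x, continuous cmap};
  cinv_cont : forall x, cdom x -> {for cmap x, continuous cinv} }.

Record manifold (R : realType) (n : nat) := Manifold {
  carrier :> topologicalType;
  carrier_hausdorff : hausdorff_space carrier;
  carrier_second_countable : @second_countable carrier;
  atlas : set (chart R n carrier);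
  atlas_cover : forall x, exists2 c, atlas c & cdom c x;
  atlas_smooth : forall c d, atlas c -> atlas d -> forall j : 'I_n,
    Creg Cinf (cmap c @` (cdom c `&` cdom d))
      (fun y => cmap d (cinv c y) 0 j) }.

Section Cfunctions.
Context {R : realType} {n : nat} (X : manifold R n).
Implicit Types (U V W : opens X) (r : regularity).

Lemma chart_img_open (c : chart R n X) (U : set X) : open U ->
  open (cmap c @` (U `&` cdom c)).
Proof.
move=> oU; rewrite openE => _ [x [Ux cx] <-]; rewrite /interior.
have h1 : \forall y \near cmap c x, (cmap c @` cdom c) y.
  by apply: open_nbhs_nbhs; split; [exact: cimg_open|exists x].
have h2 : \forall y \near cmap c x, U (cinv c y).
  apply: (cinv_cont cx); rewrite (cmapK cx).
  by apply: open_nbhs_nbhs; split.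
apply: filterS2 h1 h2 => _ [z cz <-]; rewrite (cmapK cz) => Uz.
by exists z.
Qed.

(* A real function on U is represented by its extension by 0 to X. *)
Definition is_C r U : {pred X -> R} := fun f =>
  `[< (forall x, ~ oset U x -> f x = 0) /\
      forall c, atlas c -> Creg r (cmap c @` (U `&` cdom c)) (f \o cinv c) >].

Lemma is_C_submod r U : submod_closed (is_C r U).
Proof.
split=> [|a f g /asboolP[f0 fC] /asboolP[g0 gC]].
  apply/asboolP; split=> // c _; apply: Creg_cst.
  by apply: chart_img_open; exact: oset_open.
apply/asboolP; split=> [x Ux|c Ac].
  by rewrite -[LHS]/(a * f x + g x) f0 // g0 // mulr0 addr0.
apply: (Creg_lin a _ (fC c Ac) (gC c Ac)).
by apply: chart_img_open; exact: oset_open.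
Qed.
HB.instance Definition _ r U :=
  GRing.isSubmodClosed.Build R (X -> R) (is_C r U) (is_C_submod r U).

Record C_sec r U := CSec { cfun :> X -> R; _ : cfun \in is_C r U }.
HB.instance Definition _ r U := [isSub for @cfun r U].
HB.instance Definition _ r U := [Choice of C_sec r U by <:].
HB.instance Definition _ r U := [SubChoice_isSubLmodule of C_sec r U by <:].

Lemma C_secP r U (f g : C_sec r U) : (forall x, oset U x -> f x = g x) -> f = g.
Proof.
move=> fg; apply/val_inj/funext => x /=.
have [Ux|Ux] := pselect (oset U x); first exact: fg.
case: f g {fg} => [f /asboolP[f0 _]] [g /asboolP[g0 _]] /=.
by rewrite f0 ?g0.
Qed.

Lemma C_sec_reg r U (f : C_sec r U) c : atlas c ->
  Creg r (cmap c @` (U `&` cdom c)) (f \o cinv c).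
Proof. by move=> Ac; case: f => f /= /asboolP[_]; exact. Qed.

Lemma C_linE r U a (f g : C_sec r U) x : (a *: f + g) x = a * f x + g x.
Proof. by []. Qed.

Lemma patch_C r U V (f : X -> R) : (forall c, atlas c ->
    Creg r (cmap c @` (V `&` cdom c)) (f \o cinv c)) ->
  patch (fun=> 0) V f \in is_C r V.
Proof.
move=> fC; apply/asboolP; split=> [x Vx|c Ac].
  by rewrite /patch memNset.
apply: eq_Creg (fC c Ac); first by apply: chart_img_open; exact: oset_open.
by move=> _ [x [Vx cx] <-] /=; rewrite (cmapK cx) /patch mem_set.
Qed.

Lemma C_res_subproof r U V (h : V `<=` U) (f : C_sec r U) :
  patch (fun=> 0) V f \in is_C r V.
Proof.
apply: patch_C => // c Ac; apply: Creg_sub (C_sec_reg f Ac).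
by apply: image_subset; exact: setSI.
Qed.
Definition C_res r U V (h : V `<=` U) (f : C_sec r U) : C_sec r V :=
  CSec (C_res_subproof h f).

Lemma C_resE r U V (h : V `<=` U) (f : C_sec r U) x : oset V x -> C_res h f x = f x.
Proof. by move=> Vx; rewrite /= /patch mem_set. Qed.

Lemma C_res_linear r U V (h : V `<=` U) : linear (@C_res r U V h).
Proof.
move=> a f g; apply: C_secP => x Vx.
by rewrite C_linE !C_resE.
Qed.

Lemma C_res_id r U (h : U `<=` U) (f : C_sec r U) : C_res h f = f.
Proof. by apply: C_secP => x Ux; rewrite C_resE. Qed.

Lemma C_res_comp r U V W (hVU : V `<=` U) (hWV : W `<=` V) (hWU : W `<=` U)
  (f : C_sec r U) : C_res hWV (C_res hVU f) = C_res hWU f.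
Proof. by apply: C_secP => x Wx; rewrite !C_resE //; exact: hWV. Qed.

Lemma C_glue r U (I : Type) (V : I -> opens X) (hV : forall i, V i `<=` U) :
  U `<=` \bigcup_i V i -> forall s : (forall i, C_sec r (V i)),
  (forall i j W (hi : W `<=` V i) (hj : W `<=` V j),
     C_res hi (s i) = C_res hj (s j)) ->
  exists! t : C_sec r U, forall i, C_res (hV i) t = s i.
Proof.
move=> cov s compat.
have sE i j x : oset (V i) x -> oset (V j) x -> s i x = s j x.
  move=> Vix Vjx.
  have hi : opensI (V i) (V j) `<=` V i by move=> z [].
  have hj : opensI (V i) (V j) `<=` V j by move=> z [].
  have /(congr1 (fun u : C_sec r _ => u x)) := compat i j _ hi hj.
  by rewrite !C_resE.
pose t0 x := if pselect (exists i, oset (V i) x) is left h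
  then s (projT1 (cid h)) x else 0.
have t0E i x : oset (V i) x -> t0 x = s i x.
  move=> Vix; rewrite /t0; case: pselect => [h|[]]; last by exists i.
  by apply: sE => //; exact: (projT2 (cid h)).
have tC : patch (fun=> 0) U t0 \in is_C r U.
  apply: patch_C => // c Ac; apply: Creg_local => _ [x [Ux cx] <-].
  have [i _ Vix] := cov _ Ux.
  exists (cmap c @` (V i `&` cdom c)); first by exists x.
  apply: eq_Creg (C_sec_reg (s i) Ac).
    by apply: chart_img_open; exact: oset_open.
  by move=> _ [z [Vz cz] <-] /=; rewrite (cmapK cz) (t0E i).
exists (CSec tC); split=> [i|t tP].
  apply: C_secP => x Vx; rewrite C_resE // -(t0E i) //= /patch mem_set //.
  exact: (hV i).
apply: C_secP => x Ux; have [i _ Vix] := cov _ Ux.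
by rewrite /= /patch mem_set // (t0E i) // -tP C_resE.
Qed.

Definition Csheaf r : sheaf R X :=
  @Sheaf R X (C_sec r) (@C_res r) (@C_res_linear r) (@C_res_id r)
    (@C_res_comp r) (@C_glue r).

End Cfunctions.
Arguments Csheaf {R n} X r.

Section DiffOps.
Context {R : realType} {n : nat} (X : manifold R n).

(* The multi-indices alpha with |alpha| <= k are the elements of this finite
   type with mdeg alpha <= k, since their entries are at most k. *)
Definition mindex (k : nat) := {ffun 'I_n -> 'I_k.+1}.

Section Sections.
Variables (k : nat) (r : regularity).

(* A differential operator of order <= k with coefficients of class C^r is
   encoded by its action on functions of class C^k, with values in C^0. It
   determines the coefficients, as polynomial functions show. *)
Definition is_diffop (U : opens X) :
    {pred hom_sec (Csheaf X (Cfin k)) (Csheaf X (Cfin 0)) U} := fun P =>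
  `[< forall c, atlas c -> forall x, oset U x -> cdom c x ->
      exists (W : opens X) (hW : W `<=` U), [/\ oset W x, W `<=` cdom c &
      exists2 a : mindex k -> 'rV[R]_n -> R,
        forall alpha, Creg r (cmap c @` W) (a alpha) &
        forall (V : opens X) (hV : V `<=` W) (phi : Csheaf X (Cfin k) V) y,
          oset V y -> P V (subset_trans hV hW) phi y =
            \sum_(alpha : mindex k | (mdeg (fun i => alpha i) <= k)%N)
              a alpha (cmap c y) *
              pderiv (fun i => alpha i) (phi \o cinv c) (cmap c y)] >].

Arguments is_diffop : clear implicits.

Lemma chart_img_open_sub (c : chart R n X) (W : opens X) : W `<=` cdom c ->
  open (cmap c @` W).
Proof.
move=> hW; rewrite (_ : oset W = oset W `&` cdom c).
  by apply: chart_img_open; exact: oset_open.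
by apply/esym/setIidl.
Qed.

Lemma is_diffop_submod U : submod_closed (is_diffop U).
Proof.
split=> [|b P Q /asboolP PD /asboolP QD].
  apply/asboolP => c Ac x Ux cx.
  have oW : open (oset U `&` cdom c) by apply: openI; [exact: oset_open|exact: cdom_open].
  have hW : Opens oW `<=` U by move=> z [].
  have hWc : Opens oW `<=` cdom c by move=> z [].
  exists (Opens oW), hW; split => //.
  exists (fun _ _ => 0) => [alpha|V hV phi y Vy].
    by apply: Creg_cst; exact: chart_img_open_sub.
  by rewrite big1 // => alpha _; rewrite mul0r.
apply/asboolP => c Ac x Ux cx.
have [W1 [h1 [W1x W1c [a1 a1C PE]]]] := PD c Ac x Ux cx.
have [W2 [h2 [W2x W2c [a2 a2C QE]]]] := QD c Ac x Ux cx.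
have s1 : opensI W1 W2 `<=` W1 by move=> z [].
have s2 : opensI W1 W2 `<=` W2 by move=> z [].
exists (opensI W1 W2), (subset_trans s1 h1); split=> //.
  exact: subset_trans s1 W1c.
exists (fun alpha y => b * a1 alpha y + a2 alpha y) => [alpha|V hV phi y Vy].
  apply: Creg_lin; first by apply: chart_img_open_sub; exact: subset_trans s1 W1c.
    by apply: Creg_sub (a1C alpha); exact: image_subset.
  by apply: Creg_sub (a2C alpha); exact: image_subset.
rewrite hom_linE C_linE.
rewrite (hmap_irr _ _ (subset_trans (subset_trans hV s1) h1)) PE //.
rewrite (hmap_irr Q _ (subset_trans (subset_trans hV s2) h2)) QE //.
rewrite mulr_sumr -big_split /=; apply: eq_bigr => alpha _.
by rewrite mulrDl mulrA.
Qed.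
HB.instance Definition _ U := GRing.isSubmodClosed.Build R
  (hom_sec (Csheaf X (Cfin k)) (Csheaf X (Cfin 0)) U)
  (is_diffop U) (is_diffop_submod U).

Record D_sec U := DSec {
  dop :> hom_sec (Csheaf X (Cfin k)) (Csheaf X (Cfin 0)) U;
  _ : dop \in is_diffop U }.
HB.instance Definition _ U := [isSub for @dop U].
HB.instance Definition _ U := [Choice of D_sec U by <:].
HB.instance Definition _ U := [SubChoice_isSubLmodule of D_sec U by <:].

Lemma D_secP U (P Q : D_sec U) : dop P = dop Q -> P = Q.
Proof. exact: val_inj. Qed.

Lemma D_res_subproof (U V : opens X) (h : V `<=` U) (P : D_sec U) :
  hom_restr h P \in is_diffop V.
Proof.
case: P => P /= /asboolP PD; apply/asboolP => c Ac x Vx cx.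
have [W [hW [Wx Wc [a aC PE]]]] := PD c Ac x (h _ Vx) cx.
have s1 : opensI W V `<=` W by move=> z [].
have s2 : opensI W V `<=` V by move=> z [].
exists (opensI W V), s2; split=> //; first exact: subset_trans s1 Wc.
exists a => [alpha|Z hZ phi y Zy].
  by apply: Creg_sub (aC alpha); exact: image_subset.
by rewrite -PE //=; [exact: subset_trans hZ s1|move=> hZW; rewrite (hmap_irr _ _ (subset_trans hZW hW))].
Qed.
Definition D_res (U V : opens X) (h : V `<=` U) (P : D_sec U) : D_sec V :=
  DSec (D_res_subproof h P).

Lemma D_res_linear (U V : opens X) (h : V `<=` U) : linear (D_res h).
Proof. by move=> a P Q; apply: D_secP; exact: hom_restr_linear. Qed.
Lemma D_res_id (U : opens X) (h : U `<=` U) P : D_res h P = P.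
Proof. by apply: D_secP; exact: hom_restr_id. Qed.
Lemma D_res_comp (U V W : opens X) (hVU : V `<=` U) (hWV : W `<=` V)
  (hWU : W `<=` U) P : D_res hWV (D_res hVU P) = D_res hWU P.
Proof. by apply: D_secP; exact: hom_restr_comp. Qed.

Lemma D_glue (U : opens X) (I : Type) (V : I -> opens X)
  (hV : forall i, V i `<=` U) : U `<=` \bigcup_i V i ->
  forall s : (forall i, D_sec (V i)),
  (forall i j (W : opens X) (hi : W `<=` V i) (hj : W `<=` V j),
     D_res hi (s i) = D_res hj (s j)) ->
  exists! t : D_sec U, forall i, D_res (hV i) t = s i.
Proof.
move=> cov s compat.
have [|S [SP Suniq]] := hom_glue hV cov (T := fun i => dop (s i)).
  by move=> i j W hi hj; have /(congr1 (@dop W)) := compat i j W hi hj.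
have SD : S \in is_diffop U.
  apply/asboolP => c Ac x Ux cx; have [i _ Vx] := cov _ Ux.
  have := SP i; case: (s i) => P /= /asboolP PD SE.
  have [W [hW [Wx Wc [a aC PE]]]] := PD c Ac x Vx cx.
  exists W, (subset_trans hW (hV i)); split=> //; exists a => // Z hZ phi y Zy.
  by rewrite -(PE _ hZ) // -SE /=; congr (cfun (S Z _ phi) y); exact: Prop_irrelevance.
exists (DSec SD); split=> [i|t tP]; first by apply: D_secP; exact: SP.
by apply: D_secP; apply: Suniq => i; rewrite -tP.
Qed.

Definition diffop_sheaf : sheaf R X :=
  @Sheaf R X D_sec D_res D_res_linear D_res_id D_res_comp D_glue.

End Sections.

(* D^{k,r}; the order None stands for any negative order, -oo included. *)
Definition Dsheaf (k : option nat) (r : regularity) : sheaf R X :=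
  if k is Some k then diffop_sheaf k r else zero_sheaf R X.

Definition order_sub (m : nat) (r : regularity) : option nat :=
  match r with
  | Cfin r => if (r <= m)%N then Some (m - r)%N else None
  | Cinf => None
  end.

Section Action.
Variables (k m r : nat).
Hypothesis krm : (k + r <= m)%N.

Lemma C_incl_subproof (U : opens X) (f : C_sec (Cfin m) U) :
  (f : X -> R) \in is_C (Cfin k) U.
Proof.
case: f => f /= /asboolP[f0 fC]; apply/asboolP; split=> // c Ac.
by apply: Cnat_le (fC c Ac); exact: leq_trans (leq_addr r k) krm.
Qed.
Definition C_incl (U : opens X) (f : C_sec (Cfin m) U) : C_sec (Cfin k) U :=
  CSec (C_incl_subproof f).

Section Act.
Variables (U : opens X) (P : D_sec k (Cfin r) U).

Lemma act_subproof (V : opens X) (h : V `<=` U) (f : C_sec (Cfin m) V) :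
  (P V h (C_incl f) : X -> R) \in is_C (Cfin r) V.
Proof.
have g0 : forall x, ~ oset V x -> P V h (C_incl f) x = 0.
  by case: (P V h (C_incl f)) => g /= /asboolP[].
apply/asboolP; split=> // c Ac.
apply: Creg_local => _ [x [Vx cx] <-].
case: P => Q /= /asboolP QD.
have [W [hW [Wx Wc [a aC QE]]]] := QD c Ac x (h _ Vx) cx.
pose Z := opensI W V.
have s1 : Z `<=` W by move=> z [].
have s2 : Z `<=` V by move=> z [].
have sc : Z `<=` cdom c by exact: subset_trans s1 Wc.
exists (cmap c @` Z); first by exists x.
have oZ := chart_img_open_sub sc.
pose F y := \sum_(alpha : mindex k | (mdeg (fun i => alpha i) <= k)%N)
  a alpha y * pderiv (fun i => alpha i) (f \o cinv c) y.
have FE : forall y, (cmap c @` Z) y -> F y = (Q V h (C_incl f) \o cinv c) y.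
  move=> _ [z Zz <-]; rewrite /= cmapK; last exact: sc.
  rewrite -(C_resE s2) //.
  have /(congr1 (fun u : C_sec _ _ => u z)) /= <- :=
    hmap_res Q h (subset_trans s1 hW) s2 (C_incl f).
  rewrite QE //; apply: eq_bigr => alpha _; congr (_ * _).
  apply: (eq_pderiv _ oZ); last by exists z.
  move=> _ [t Zt <-] /=; rewrite cmapK; last exact: sc.
  by rewrite /patch mem_set.
apply: (eq_Cnat oZ FE); apply: Cnat_sum => // alpha alphak.
apply: Cnat_mul => //.
  by apply: Cnat_sub (aC alpha); exact: image_subset.
apply: Cnat_pderiv; apply: (@Cnat_le _ _ _ m).
  by apply: leq_trans krm; rewrite addnC leq_add2r.
apply: Cnat_sub (C_sec_reg f Ac); apply: image_subset => z Zz.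
by split; [exact: s2|exact: sc].
Qed.

Definition act_map (V : opens X) (h : V `<=` U) (f : C_sec (Cfin m) V) :
  C_sec (Cfin r) V := CSec (act_subproof h f).

Lemma act_linear (V : opens X) (h : V `<=` U) : linear (act_map h).
Proof.
move=> a f g; apply: C_secP => x Vx.
have := hmap_linear (dop P) h a (C_incl f) (C_incl g).
move=> /(congr1 (fun u : C_sec (Cfin 0) V => u x)) E; apply: etrans E.
by congr (cfun (P V h _) x); exact: C_secP.
Qed.

Lemma act_res (V W : opens X) (hVU : V `<=` U) (hWU : W `<=` U)
    (hWV : W `<=` V) (f : C_sec (Cfin m) V) :
  act_map hWU (C_res hWV f) = C_res hWV (act_map hVU f).
Proof.
apply: C_secP => x Wx.
have := hmap_res (dop P) hVU hWU hWV (C_incl f).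
move=> /(congr1 (fun u : C_sec (Cfin 0) W => u x)) E; apply: etrans E.
by congr (cfun (P W hWU _) x); exact: C_secP.
Qed.

Definition act : Hom (Csheaf X (Cfin m)) (Csheaf X (Cfin r)) U :=
  @HomSec R X (Csheaf X (Cfin m)) (Csheaf X (Cfin r)) U act_map
    act_linear act_res.
End Act.

Lemma act_is_linear U : linear (@act U).
Proof.
move=> a P Q; apply: hom_secP => V h f; rewrite hom_linE.
apply: C_secP => x Vx.
exact: (congr1 (fun u : C_sec (Cfin 0) V => u x)
  (hom_linE a (dop P) (dop Q) h (C_incl f))).
Qed.

Lemma act_restr (U V : opens X) (h : V `<=` U) P :
  act (D_res h P) = hom_restr h (act P).
Proof. by apply: hom_secP => W hW f; exact: C_secP. Qed.

Definition action : sheaf_hom (diffop_sheaf k (Cfin r))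
    (Hom (Csheaf X (Cfin m)) (Csheaf X (Cfin r))) :=
  @SheafHom R X (diffop_sheaf k (Cfin r)) (Hom _ _) act act_is_linear act_restr.
End Action.

(* The morphism P |-> (phi |-> P phi) from D^{m-r,r} to Hom(C^m, C^r). *)
Definition natural_morphism (m : nat) (r : regularity) :
    sheaf_hom (Dsheaf (order_sub m r) r) (Hom (Csheaf X (Cfin m)) (Csheaf X r)) :=
  match r with
  | Cfin r => match boolP (r <= m)%N in alt_spec _ _ b return
      sheaf_hom (Dsheaf (if b then Some (m - r)%N else None) (Cfin r))
        (Hom (Csheaf X (Cfin m)) (Csheaf X (Cfin r))) with
    | AltTrue rm => action (eq_leq (subnK rm))
    | AltFalse _ => zero_hom _
    end
  | Cinf => zero_hom _
  end.
End DiffOps.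
Arguments natural_morphism {R n} X m r.

(* Main.v *)
Require Import Defs.
From HB Require Import structures.
From mathcomp Require Import all_boot all_order all_algebra.
From mathcomp Require Import all_classical all_reals all_analysis.
From mathcomp Require Import ring lra.
Set Implicit Arguments.
Unset Strict Implicit.
Unset Printing Implicit Defensive.
Import Order.TTheory GRing.Theory Num.Theory.
Import numFieldNormedType.Exports.
Local Open Scope classical_set_scope.
Local Open Scope ring_scope.

(** Let T be a morphism of sheaves from C^m to C^r over U. No continuity of T is
    assumed; its locality, together with the continuity of the functions in its
    image, replaces it.

    Jets. If phi is flat of order m at x (all its derivatives of order at most m
    vanish there), then T phi vanishes at x ([hom_flat]). Indeed phi can be
    multiplied by a function which is homogeneous of degree 0 around x, equal to
    0 on a cone with vertex x and to 1 on the opposite cone; flatness makes the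
    product psi of class C^m across the vertex ([glue_Cnat], [flat_split]). By
    locality T psi is 0 on the first open cone and T phi on the second one. As x
    belongs to the closure of both cones, T phi and 0 agree at x by continuity.

    Local form. Subtract from phi its Taylor polynomial at x: T phi (x) depends
    only on the m-jet of phi at x, so that in a chart T is the sum over
    |a| <= m of the coef_a d^a, with coef_a (y) = T((. - y)^a) (y) / a!
    ([hom_jet_sum]). The binomial formula expresses coef_a through the
    functions T(z^b), which are of class C^r, with polynomial factors, hence
    coef_a is of class C^r ([Creg_coef]).

    Order. Apply T to z |-> max(0, xi.(z - x))^(m+1), which is of class C^m only.
    Its image vanishes on a half-space bounded by a hyperplane through x, so it
    is flat of order s at x as soon as it is of class C^s. By descending
    induction on l, assume that the coefficients of degree greater than l
    vanish, and take s = m + 1 - l: on the other side of the hyperplane the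
    image is xi.(z - x)^s times a continuous function whose value at x is a
    nonzero multiple of the principal symbol, the sum over |a| = l of
    coef_a(x) xi^a. Being o(|z - x|^s), it has a zero symbol ([symbol_eq0]), for
    all xi, and so the coefficients of degree l vanish. This proceeds as long
    as s <= r, that is down to l = m - r + 1, or to l = 0 when m < r
    ([coef_eq0]).

    Conclusion. If m < r, then T = 0. Otherwise put k = m - r: the local
    formulas have order k and make sense on functions of class C^k. They agree
    in different charts, because a function of class C^k has at each point the
    same k-jet as a function of class C^m, and k-flatness is preserved by
    changes of coordinates ([flat_comp], [jet_sum_chart]). So they define a
    differential operator inducing T. The same approximation of k-jets by Taylor
    polynomials shows that the operator is determined by T. *)

(** * Mean value estimates *)

Section MeanValue.
Context {R : realType} {n : nat}.
Implicit Types (f g : 'rV[R]_n -> R) (x y z v : 'rV[R]_n) (W : set 'rV[R]_n).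

Lemma is_derive_line f x v (d t : R) : is_derive (t *: v + x) v f d ->
  is_derive (t : R) (1 : R) (fun s : R => f (s *: v + x)) d.
Proof.
move=> [fd fE]; split.
  move: fd; rewrite /derivable; set g1 := fun h => h^-1 *: _.
  set g2 := fun h => h^-1 *: _; suff -> : g1 = g2 by [].
  by rewrite funeqE /g1 /g2 => h /=; rewrite scalerDl [h%:A]mulr1 addrA.
move: fE; rewrite /derive; set g1 := fun h => h^-1 *: _.
set g2 := fun h => h^-1 *: _; suff -> : g1 = g2 by [].
by rewrite funeqE /g1 /g2 => h /=; rewrite scalerDl [h%:A]mulr1 addrA.
Qed.

Lemma is_derive_of_line f x v (d : R) :
  is_derive (0 : R) (1 : R) (fun s : R => f (s *: v + x)) d ->
  is_derive x v f d.
Proof.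
move=> [fd fE]; split; first exact/derivable1P.
move: fE; rewrite /derive; set g1 := fun h => h^-1 *: _.
set g2 := fun h => h^-1 *: _; suff -> : g1 = g2 by [].
by rewrite funeqE /g1 /g2 => h /=; rewrite addr0 scale0r add0r [h%:A]mulr1.
Qed.

Lemma mvt_partial f x (i : 'I_n) (h : R) :
  (forall t, `|t| <= `|h| -> derivable f (t *: delta_mx 0 i + x) (delta_mx 0 i)) ->
  exists2 t, `|t| <= `|h| &
    f (h *: delta_mx 0 i + x) - f x = h * partial i f (t *: delta_mx 0 i + x).
Proof.
move=> fd; set e := delta_mx 0 i.
pose g (s : R) := f (s *: e + x); pose dg (s : R) := partial i f (s *: e + x).
have gd t : `|t| <= `|h| -> is_derive (t : R) (1 : R) g (dg t).
  by move=> th; apply: is_derive_line; apply: derivableP; exact: fd.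
have gc (a b : R) : (forall t, a <= t <= b -> `|t| <= `|h|) ->
    {within `[a, b], continuous g}.
  move=> ab; apply: derivable_within_continuous => t; rewrite in_itv /= => tab.
  by case: (gd t (ab _ tab)).
have [h0|h0] := leP 0 h.
  have sub t : 0 <= t <= h -> `|t| <= `|h|.
    by move=> /andP[t0 th]; rewrite !ger0_norm // (le_trans t0).
  have [|c] := MVT_segment (df := dg) h0 _ (gc _ _ sub).
    by move=> t; rewrite in_itv /= => /andP[/ltW t0 /ltW th]; apply: gd; rewrite sub // t0.
  rewrite in_itv /= => /sub ch E; exists c => //.
  by move: E; rewrite /g scale0r add0r subr0 mulrC.
have sub t : h <= t <= 0 -> `|t| <= `|h|.
  by move=> /andP[ht t0]; rewrite !ler0_norm ?lerN2 // ltW.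
have [|c] := MVT_segment (df := dg) (ltW h0) _ (gc _ _ sub).
  by move=> t; rewrite in_itv /= => /andP[/ltW t0 /ltW th]; apply: gd; rewrite sub // t0.
rewrite in_itv /= => /sub ch E; exists c => //.
move: E; rewrite /g scale0r add0r sub0r mulrN => /(congr1 -%R).
by rewrite opprB opprK mulrC.
Qed.

Lemma coord_le_norm x i : `|x 0 i| <= `|x|.
Proof.
rewrite [leRHS]/Num.Def.normr/= mx_normrE.
exact: (le_bigmax _ (fun p : 'I_1 * 'I_n => `|x p.1 p.2|) (0, i)).
Qed.

Lemma norm_le_coord x (M : R) : 0 <= M -> (forall i, `|x 0 i| <= M) -> `|x| <= M.
Proof.
move=> M0 xM; rewrite [leLHS]/Num.Def.normr/= mx_normrE.
by apply: bigmax_le => // -[a i] _ /=; rewrite ord1.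
Qed.

Lemma norm_delta_le1 (i : 'I_n) : `|delta_mx 0 i : 'rV[R]_n| <= 1.
Proof.
apply: norm_le_coord => // j; rewrite mxE eqxx /=.
by case: (j == i); rewrite ?normr0 ?normr1.
Qed.

(** The segment from [x] to [y] is replaced by a path which changes the
    coordinates one at a time; for the sup norm it stays in the ball. *)
Lemma box_mean_value f x (M rho : R) : 0 <= M ->
  (forall y, `|y - x| <= rho -> forall i, derivable f y (delta_mx 0 i)) ->
  (forall y, `|y - x| <= rho -> forall i, `|partial i f y| <= M) ->
  forall y, `|y - x| <= rho -> `|f y - f x| <= n%:R * M * `|y - x|.
Proof.
move=> M0 fd fM y yrho.
pose z k : 'rV[R]_n := \row_j (if (j < k)%N then y 0 j else x 0 j).
suff H : forall k, (k <= n)%N -> `|f (z k) - f x| <= k%:R * M * `|y - x|.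
  by have := H n (leqnn n); rewrite (_ : z n = y) //; apply/rowP => j; rewrite mxE ltn_ord.
elim=> [_|k IH kn].
  rewrite (_ : z 0%N = x) ?subrr ?normr0 ?mul0r //.
  by apply/rowP => j; rewrite mxE.
pose i := Ordinal kn; pose h := y 0 i - x 0 i.
have zS : z k.+1 = h *: delta_mx 0 i + z k.
  apply/rowP => j; rewrite !mxE eqxx /= ltnS leq_eqVlt.
  have [->|ji] := eqVneq j i; first by rewrite /= eqxx ltnn /h mulr1 subrK.
  by rewrite mulr0 add0r; case: (eqVneq (j : nat) k) ji => //= jk; rewrite -val_eqE /= jk eqxx.
have hle : `|h| <= `|y - x| by have := coord_le_norm (y - x) i; rewrite !mxE.
have inbox (t : R) : `|t| <= `|h| -> `|t *: delta_mx 0 i + z k - x| <= rho.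
  move=> th; apply: le_trans yrho; apply: norm_le_coord => // j.
  rewrite !mxE eqxx /=; have [->|ji] := eqVneq j i.
    by rewrite /= ltnn mulr1 addrK (le_trans th).
  rewrite mulr0 add0r; case: ifP => _; last by rewrite subrr normr0.
  by have := coord_le_norm (y - x) j; rewrite !mxE.
have [|t th E] := @mvt_partial f (z k) i h; first by move=> t /inbox/fd; apply.
have -> : f (z k.+1) - f x = (f (z k.+1) - f (z k)) + (f (z k) - f x) by rewrite addrA subrK.
rewrite zS E; apply: le_trans (ler_normD _ _) _.
rewrite -natr1 [in leRHS]mulrDl [in leRHS]mulrDl mul1r addrC.
apply: lerD; first exact: IH (ltnW kn).
rewrite normrM mulrC; apply: ler_pM => //; exact: fM (inbox _ th) _.
Qed.

Lemma near_box (P : 'rV[R]_n -> Prop) x : (\forall y \near x, P y) ->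
  exists2 r : R, 0 < r & forall y, `|y - x| <= r -> P y.
Proof.
move=> /nbhs_ballP[e /= e0 eP]; exists (e / 2); first by rewrite divr_gt0.
move=> y yx; apply: eP; rewrite -ball_normE /ball_ /= distrC.
by apply: le_lt_trans yx _; rewrite ltr_pdivrMr // ltr_pMr // ltr1n.
Qed.

Lemma box_near (P : 'rV[R]_n -> Prop) x (r : R) : 0 < r ->
  (forall y, `|y - x| <= r -> P y) -> \forall y \near x, P y.
Proof.
move=> r0 rP; apply/nbhs_ballP; exists r => // y; rewrite -ball_normE /ball_ /= distrC => yx.
by apply: rP; exact: ltW.
Qed.

Lemma C1_partial_continuous W f i y : Cnat 1 W f -> W y ->
  {for y, continuous (partial i f)}.
Proof. by move=> [_ /(_ i)[_]] + Wy; apply. Qed.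

Lemma near_le_of_continuous f y (e : R) : {for y, continuous f} -> 0 < e ->
  \forall z \near y, `|f z - f y| <= e.
Proof.
move=> fc e0; have /cvgrPdist_le/(_ _ e0) := fc.
by apply: filterS => z; rewrite distrC.
Qed.

Lemma continuous_of_near_le f y :
  (forall e : R, 0 < e -> \forall z \near y, `|f z - f y| <= e) ->
  {for y, continuous f}.
Proof.
move=> H; apply: (iffRL (@cvgrPdist_le _ _ _ (nbhs y) (nbhs_filter y) f (f y))) => e e0.
by apply: filterS (H e e0) => z; rewrite distrC.
Qed.

(** The form in which continuity is used below: two functions that agree at
    points arbitrarily close to [y], although on no neighbourhood of it. *)
Lemma eq_of_accumulation (G1 G2 : 'rV[R]_n -> R) y :
  {for y, continuous G1} -> {for y, continuous G2} ->
  (forall e : R, 0 < e -> exists2 z, `|z - y| <= e & G1 z = G2 z) -> G1 y = G2 y.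
Proof.
move=> c1 c2 acc; apply/eqP; rewrite -subr_eq0 -normr_le0; apply/ler_addgt0Pr => e e0.
have e20 : 0 < e / 2 by rewrite divr_gt0.
have [s s0 sP] := near_box (filterI (near_le_of_continuous c1 e20)
  (near_le_of_continuous c2 e20)).
have [z zs Ez] := acc s s0; have [z1 z2] := sP z zs.
rewrite add0r (_ : G1 y - G2 y = (G2 z - G2 y) - (G1 z - G1 y)); last by rewrite Ez; ring.
by rewrite (splitr e); apply: le_trans (ler_normB _ _) (lerD z2 z1).
Qed.

Lemma small_ray W y v (e : R) : open W -> W y -> 0 < e ->
  exists t : R, [/\ 0 < t, `|t *: v + y - y| <= e & W (t *: v + y)].
Proof.
move=> oW Wy e0; have [e1 e10 eP] := near_box (open_nbhs_nbhs (conj oW Wy)).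
have v0 : 0 < `|v| + 1 by rewrite ltr_wpDl.
have m0 : 0 < Num.min e e1 by rewrite lt_min e0.
pose t := Num.min e e1 / (`|v| + 1).
have t0 : 0 < t by rewrite divr_gt0.
have le : `|t *: v + y - y| <= Num.min e e1.
  rewrite addrK normrZ gtr0_norm // mulrAC ler_pdivrMr //.
  by apply: ler_wpM2l; [exact: ltW|rewrite lerDl].
exists t; split=> //; first by apply: le_trans le _; rewrite ge_min lexx.
by apply: eP; apply: le_trans le _; rewrite ge_min lexx orbT.
Qed.

Lemma near_partials W f y (e : R) : open W -> W y -> Cnat 1 W f -> 0 < e ->
  exists r, [/\ 0 < r, forall z, `|z - y| <= r -> W z &
    forall z, `|z - y| <= r -> forall i, `|partial i f z - partial i f y| <= e].
Proof.
move=> oW Wy fC e0.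
have H1 : \forall z \near y, W z by exact: open_nbhs_nbhs.
have H2 : \forall z \near y, forall i, `|partial i f z - partial i f y| <= e.
  apply: (@filter_forall _ _ (fun i z => `|partial i f z - partial i f y| <= e)
    (nbhs y) (nbhs_filter y)) => i.
  by apply: near_le_of_continuous => //; exact: C1_partial_continuous Wy.
by have [r r0 rP] := near_box (filterI H1 H2); exists r; split=> // z /rP[].
Qed.

(** [box_mean_value] applied to [f] minus its linear part, whose partial
    derivatives are small near [y]. *)
Lemma frechet_expansion W f y (e : R) : open W -> W y -> Cnat 1 W f -> 0 < e ->
  \forall z \near y,
    `|f z - f y - \sum_i (z - y) 0 i * partial i f y| <= e * `|z - y|.
Proof.
move=> oW Wy fC e0.
have e'0 : 0 < e / n.+1%:R by rewrite divr_gt0.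
have [r [r0 rW rP]] := near_partials oW Wy fC e'0.
apply: (box_near r0) => z zr.
pose L (z : 'rV[R]_n) := \sum_i (z - y) 0 i * partial i f y.
have Ld w i : is_derive w (delta_mx 0 i) L (partial i f y).
  apply: is_derive_of_line.
  rewrite (_ : (fun s => _) = (fun s : R => s * partial i f y + L w)); last first.
    apply/funext => s; rewrite /L (bigD1 i) //= [X in _ = _ + X](bigD1 i) //=.
    rewrite !mxE !eqxx /= mulr1 -addrA mulrDl -addrA; congr (_ + (_ + _)).
    by apply: eq_bigr => j ji; rewrite !mxE (negbTE ji) mulr0 add0r.
  by apply: is_derive_eq; rewrite addr0 scaler0 add0r [_%:A]mulr1.
have fd w : `|w - y| <= r -> forall i, is_derive w (delta_mx 0 i) (fun z => f z - L z)
    (partial i f w - partial i f y).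
  move=> /rW Ww i; have [_ /(_ i) [/(_ _ Ww) fdw _]] := fC.
  by have := @is_deriveB _ _ _ _ _ _ _ _ _ (derivableP fdw) (Ld w i).
have := @box_mean_value (fun z => f z - L z) y (e / n.+1%:R) r (ltW e'0) _ _ z zr.
have Ly : L y = 0 by rewrite /L big1 // => i _; rewrite subrr mxE mul0r.
rewrite Ly subr0 -/(L z) addrAC => /(_ _ _)/le_trans; apply.
- by move=> w /fd + i => /(_ i)[].
- by move=> w wr i; rewrite /partial; have [_ ->] := fd w wr i; exact: rP.
- apply: ler_wpM2r => //; rewrite mulrCA ger_pMr // ler_pdivrMr // mul1r.
  by rewrite ler_nat.
Qed.

End MeanValue.

(** * Composition of C^1 functions *)

Section ChainRule.
Context {R : realType} {n : nat}.
Implicit Types (f g : 'rV[R]_n -> R) (x y z : 'rV[R]_n) (W : set 'rV[R]_n).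

Lemma C1_differentiable W f y : open W -> W y -> Cnat 1 W f -> differentiable f y.
Proof.
move=> oW Wy fC.
pose L (v : 'rV[R]_n) : R^o := \sum_i v 0 i * partial i f y.
have Llin : linear L.
  move=> a u v; rewrite /L scaler_sumr -big_split /=; apply: eq_bigr => i _.
  by rewrite !mxE mulrDl -mulrA.
pose LM := GRing.isLinear.Build _ _ _ _ _ Llin.
pose LL : {linear 'rV[R]_n -> R^o} := HB.pack L LM.
have Lc : continuous L.
  apply: continuous_big => [|i _ v]; first exact: add_continuous.
  exact: (cvgM (@coord_continuous R 1 n 0 i v) (cvg_cst _)).
have E : (f : 'rV[R]_n -> R^o) \o shift y = cst (f y) + LL +o_ (0 : 'rV[R]_n) id.
  apply/eqaddoP => e e0.
  have H := frechet_expansion oW Wy fC e0.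
  rewrite (near_shift 0) subr0 /= in H.
  apply: filterS H => h /=; rewrite addrK.
  by rewrite -[X in _ -> `|X| <= _]/(f (h + y) - (f y + L h)) opprD addrA.
apply/diff_locallyP; rewrite (diff_unique (df := LL) Lc E).
by split.
Qed.

(** Only one-variable curves through [y] are needed, which turns derivability of
    the components of [tau] into differentiability. *)
Lemma is_derive_comp W' (tau : 'rV[R]_n -> 'rV[R]_n) f i y :
  open W' -> W' (tau y) -> Cnat 1 W' f ->
  (forall j, derivable (fun z => tau z 0 j) y (delta_mx 0 i)) ->
  is_derive y (delta_mx 0 i) (f \o tau)
    (\sum_j partial j f (tau y) * partial i (fun z => tau z 0 j) y).
Proof.
move=> oW' W'y fC dtau.
have dt : derivable tau y (delta_mx 0 i).
  by apply/derivable_mxP => a j; rewrite (ord1 a); exact: dtau.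
have df := C1_differentiable oW' W'y fC.
pose c (h : R) := tau (h *: delta_mx 0 i + y).
have dc : differentiable c 0 by apply/derivable1_diffP; exact: (iffLR (derivable1P _ _ _) dt).
have c0 : c 0 = tau y by rewrite /c scale0r add0r.
have dfc : differentiable f (c 0) by rewrite c0.
apply: is_derive_of_line; rewrite -/(f \o c).
have dF : differentiable (f \o c) 0 by exact: differentiable_comp.
apply: DeriveDef; first exact/derivable1_diffP.
rewrite deriveE // diff_comp //=.
rewrite -(deriveE (1 : R) dc) c0.
have -> : 'D_(1 : R) c (0 : R) = \row_j partial i (fun z => tau z 0 j) y.
  rewrite derive_mx; last exact/derivable1_diffP.
  apply/rowP => j; rewrite !mxE.
  have H : is_derive (0 *: delta_mx 0 i + y) (delta_mx 0 i) (fun z => tau z 0 j)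
      (partial i (fun z => tau z 0 j) y).
    by rewrite scale0r add0r; exact: derivableP.
  by case: (is_derive_line H).
rewrite [X in 'd _ _ X]row_sum_delta linear_sum; apply: eq_bigr => j _.
by rewrite linearZ /= -deriveE // mulrC mxE.
Qed.
End ChainRule.

(** * Iterated partial derivatives and flatness *)

Section Flatness.
Context {R : realType} {n : nat}.
Implicit Types (f g : 'rV[R]_n -> R) (x y z : 'rV[R]_n) (W : set 'rV[R]_n)
  (w u v : seq 'I_n).

(** Two applications of the mean value theorem. The left-hand side is symmetric
    in [i] and [j] while the right-hand side is not: this is what gives the
    commutation of partial derivatives. *)
Lemma second_difference f y i j (h : R) W : 0 < h -> Cnat 2 W f ->
  (forall z, `|z - y| <= h + h -> W z) ->
  exists2 z, `|z - y| <= h + h &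
    f (h *: delta_mx 0 i + (h *: delta_mx 0 j + y)) - f (h *: delta_mx 0 i + y)
     - (f (h *: delta_mx 0 j + y) - f y)
    = h * (h * partial j (partial i f) z).
Proof.
move=> h0 [fc fC] hW.
have e1 k (t : R) z : `|t| <= `|h| -> `|t *: delta_mx 0 k + z - y| <= h + `|z - y|.
  move=> th; rewrite -addrA; apply: le_trans (ler_normD _ _) _; apply: lerD => //.
  rewrite normrZ; apply: (@le_trans _ _ (`|h| * 1)); last by rewrite mulr1 ger0_norm // ltW.
  by apply: ler_pM => //; exact: norm_delta_le1.
have b1 k (t : R) : `|t| <= `|h| -> `|t *: delta_mx 0 k + y - y| <= h.
  by move=> /(e1 k t y); rewrite subrr normr0 addr0.
have b2 k l (t s : R) : `|t| <= `|h| -> `|s| <= `|h| ->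
    `|s *: delta_mx 0 l + (t *: delta_mx 0 k + y) - y| <= h + h.
  by move=> th sh; apply: le_trans (e1 l s _ sh) _; rewrite lerD2l; exact: b1.
have hhh : h <= h + h by rewrite lerDl ltW.
pose F z := f (h *: delta_mx 0 j + z) - f z.
have dfi k z : W z -> derivable f z (delta_mx 0 k) by move=> Wz; have [+ _] := fC k; apply.
have Fd t : `|t| <= `|h| -> is_derive (t *: delta_mx 0 i + y) (delta_mx 0 i) F
    (partial i f (h *: delta_mx 0 j + (t *: delta_mx 0 i + y))
     - partial i f (t *: delta_mx 0 i + y)).
  move=> th; apply: is_deriveB; last first.
    by apply: derivableP; apply: dfi; apply: hW; apply: le_trans (b1 _ _ th) _.
  apply: is_derive_of_line.
  rewrite (_ : (fun s => _) = (fun s : R =>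
    f (s *: delta_mx 0 i + (h *: delta_mx 0 j + (t *: delta_mx 0 i + y))))); last first.
    by apply/funext => s; rewrite addrCA.
  apply: is_derive_line; rewrite scale0r add0r.
  by apply: derivableP; apply: dfi; apply: hW; exact: b2.
have [|t th E1] := @mvt_partial R n F y i h; first by move=> t /Fd[].
have [|s sh E2] := @mvt_partial R n (partial i f) (t *: delta_mx 0 i + y) j h.
  move=> s sh; have [_ /= [_ /(_ j)[+ _]]] := fC i; apply; apply: hW; exact: b2.
exists (s *: delta_mx 0 j + (t *: delta_mx 0 i + y)); first exact: b2.
rewrite -E2; have [_ <-] := Fd _ th; rewrite -/(partial i F _) -E1 /F.
by rewrite (addrCA (h *: delta_mx 0 i)).
Qed.

Lemma schwarz W f i j y : open W -> W y -> Cnat 2 W f ->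
  partial i (partial j f) y = partial j (partial i f) y.
Proof.
move=> oW Wy fC.
apply/eqP; rewrite -subr_eq0 -normr_le0; apply/ler_addgt0Pr => e e0; rewrite add0r.
have e20 : 0 < e / 2 by rewrite divr_gt0.
have fC1 k : Cnat 1 W (partial k f) by case: fC => _ /(_ k)[].
have [r1 [r10 rW r1P]] := near_partials oW Wy (fC1 i) e20.
have [r2 [r20 _ r2P]] := near_partials oW Wy (fC1 j) e20.
pose r := Num.min r1 r2.
have r0 : 0 < r by rewrite /r lt_min r10 r20.
have rr1 z : `|z - y| <= r -> `|z - y| <= r1 by move/le_trans; apply; rewrite /r ge_min lexx.
have rr2 z : `|z - y| <= r -> `|z - y| <= r2 by move/le_trans; apply; rewrite /r ge_min lexx orbT.
pose h := r / 2.
have h0 : 0 < h by rewrite divr_gt0.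
have hh : h + h = r by rewrite -splitr.
have hW z : `|z - y| <= h + h -> W z by rewrite hh => /rr1/rW.
have [z1 z1r E1] := second_difference i j h0 fC hW.
have [z2 z2r E2] := second_difference j i h0 fC hW.
rewrite hh in z1r z2r.
have E : partial j (partial i f) z1 = partial i (partial j f) z2.
  have hN : h != 0 by rewrite gt_eqF.
  suff : h * (h * partial j (partial i f) z1) = h * (h * partial i (partial j f) z2).
    by move/(mulfI hN)/(mulfI hN).
  apply: etrans (esym E1) (etrans _ E2).
  have -> : h *: delta_mx 0 i + (h *: delta_mx 0 j + y) =
            h *: delta_mx 0 j + (h *: delta_mx 0 i + y) by exact: addrCA.
  have swap (a b c d : R) : a - b - (c - d) = a - c - (b - d) by ring.
  exact: swap.
have -> : partial i (partial j f) y - partial j (partial i f) y =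
  (partial j (partial i f) z1 - partial j (partial i f) y)
  - (partial i (partial j f) z2 - partial i (partial j f) y).
  have split_diff (a b c d : R) : c = d -> a - b = (c - b) - (d - a) by move=> ->; ring.
  exact: split_diff.
rewrite (splitr e); apply: le_trans (ler_normB _ _) _; apply: lerD.
  by apply: r1P; exact: rr1.
by apply: r2P; exact: rr2.
Qed.

(** Derivatives are indexed by words rather than by multi-indices, so that one
    more derivative can be added on either side. *)
Definition wder w f := foldr partial f w.

Lemma wder_cat u v f : wder (u ++ v) f = wder u (wder v f).
Proof. exact: foldr_cat. Qed.

Lemma wder_rcons w i f : wder (rcons w i) f = wder w (partial i f).
Proof. exact: foldr_rcons. Qed.

Lemma eq_wder W w f g : open W -> (forall y, W y -> f y = g y) ->
  forall y, W y -> wder w f y = wder w g y.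
Proof. by move=> oW fg; elim: w => //= i w IH; exact: eq_partial. Qed.

Lemma Cnat_wder k W w f : Cnat (k + size w) W f -> Cnat k W (wder w f).
Proof.
elim: w k => [|i w IH] k /=; first by rewrite addn0.
by rewrite addnS -addSn => /IH [_ /(_ i)[]].
Qed.

Lemma wder_front W u v i f : open W -> Cnat (size (u ++ i :: v)) W f ->
  forall y, W y -> wder (u ++ i :: v) f y = wder (i :: u ++ v) f y.
Proof.
move=> oW; elim: u => [|j u IH] //= fC y Wy.
apply: etrans (eq_partial j oW (IH (Cnat_pred fC)) Wy) _.
apply: (schwarz _ _ oW Wy).
apply: Cnat_wder; have -> : (2 + size (u ++ v) = (size (u ++ i :: v)).+1)%N.
  by rewrite !size_cat addnS add2n.
exact: fC.
Qed.

(** A word only matters through its letter counts, which links arbitrary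
    iterated derivatives with [pderiv], where the order of the variables is
    fixed. *)
Lemma wder_perm k W w w' f : open W -> Cnat k W f -> (size w <= k)%N ->
  perm_eq w w' -> forall y, W y -> wder w f y = wder w' f y.
Proof.
move=> oW fC; elim: w' w => [|i w' IH] w wk.
  by move=> /perm_size /size0nil ->.
move=> pw; have : i \in w by rewrite (perm_mem pw) mem_head.
move=> iw; move: wk pw; case/splitPr: iw => u v wk pw y Wy.
have szE : size (u ++ i :: v) = (size (u ++ v)).+1 by rewrite !size_cat addnS.
rewrite szE in wk.
apply: etrans (wder_front oW _ Wy) _; first by rewrite szE; exact: Cnat_le fC.
apply: (eq_partial i oW _ Wy) => z Wz; apply: IH => //; first exact: ltnW.
rewrite -(perm_cons i); apply: perm_trans pw.
by rewrite -(cat1s i (u ++ v)) -(cat1s i v) perm_catCA.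
Qed.

Definition flat k f y := forall w, (size w <= k)%N -> wder w f y = 0.

Lemma flat0 f y : flat 0 f y <-> f y = 0.
Proof. by split=> [/(_ [::] isT)|fy [|]]. Qed.

Lemma flatS k f y : flat k.+1 f y <-> f y = 0 /\ forall i, flat k (partial i f) y.
Proof.
split=> [ff|[fy ff] w]; first split; first exact: (ff [::]).
  by move=> i w wk; rewrite -wder_rcons; apply: ff; rewrite size_rcons.
by case/lastP: w => [|w i]; rewrite // size_rcons wder_rcons; exact: ff.
Qed.

Lemma flat_le k l f y : (k <= l)%N -> flat l f y -> flat k f y.
Proof. by move=> kl fl w wk; apply: fl; exact: leq_trans wk kl. Qed.

Lemma eq_flat W k f g y : open W -> W y -> (forall z, W z -> f z = g z) ->
  flat k f y -> flat k g y.
Proof. by move=> oW Wy fg fl w wk; rewrite -(eq_wder w oW fg Wy); exact: fl. Qed.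

Lemma wder0 w : wder w (fun=> 0 : R) = (fun=> 0).
Proof.
elim: w => //= i w ->; apply/funext => z; exact: (derive_cst (0 : R) z (delta_mx 0 i)).
Qed.

Lemma wder_lin W w (c : R) f g : open W -> Cnat (size w) W f -> Cnat (size w) W g ->
  forall y, W y -> wder w (fun z => c * f z + g z) y = c * wder w f y + wder w g y.
Proof.
move=> oW; elim: w => [|i w IH] //= fC gC y Wy.
apply: etrans (eq_partial i oW (IH (Cnat_pred fC) (Cnat_pred gC)) Wy) _.
have d h : Cnat (size w).+1 W h -> derivable (wder w h) y (delta_mx 0 i).
  by rewrite -add1n => /Cnat_wder [_ /(_ i)[+ _]]; apply.
have dcf := derivableZ (k := c) (d _ fC).
have E := deriveD dcf (d _ gC).
by rewrite (deriveZ c (d _ fC)) in E; exact: E.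
Qed.

Lemma wderZ W w (c : R) f : open W -> Cnat (size w) W f ->
  forall y, W y -> wder w (fun z => c * f z) y = c * wder w f y.
Proof.
move=> oW fC y Wy; have C0 : Cnat (size w) W (fun=> 0 : R) by exact: Cnat_cst.
have := wder_lin c oW fC C0 Wy; rewrite wder0 addr0 => <-; congr (wder w _ y).
by apply/funext => z; rewrite addr0.
Qed.

Lemma flat_lin W k (c : R) f g y : open W -> W y -> Cnat k W f -> Cnat k W g ->
  flat k f y -> flat k g y -> flat k (fun z => c * f z + g z) y.
Proof.
move=> oW Wy fC gC ff gf w wk.
rewrite (wder_lin c oW _ _ Wy) ?ff ?gf ?mulr0 ?addr0 //; exact: Cnat_le wk _.
Qed.

Lemma wder_sum W w (I : Type) (s : seq I) (P : pred I) (F : I -> 'rV[R]_n -> R) :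
  open W -> (forall i, P i -> Cnat (size w) W (F i)) -> forall y, W y ->
  wder w (fun z => \sum_(i <- s | P i) F i z) y = \sum_(i <- s | P i) wder w (F i) y.
Proof.
move=> oW FC y Wy; elim: s => [|i s IH].
  rewrite big_nil (_ : (fun z => _) = (fun=> 0)) ?wder0 //.
  by apply/funext => z; rewrite big_nil.
rewrite big_cons; case: ifP => Pi; last first.
  by rewrite -IH; congr (wder w _ y); apply/funext => z; rewrite big_cons Pi.
rewrite -IH -[wder w (F i) y]mul1r -(wder_lin 1 oW (FC i Pi) (Cnat_sum s oW FC) Wy).
by congr (wder w _ y); apply/funext => z; rewrite big_cons Pi mul1r.
Qed.

Lemma flat_sum W k (I : Type) (s : seq I) (P : pred I) (F : I -> 'rV[R]_n -> R) y :
  open W -> W y -> (forall i, P i -> Cnat k W (F i)) ->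
  (forall i, P i -> flat k (F i) y) -> flat k (fun z => \sum_(i <- s | P i) F i z) y.
Proof.
move=> oW Wy FC Ff w wk; rewrite (wder_sum s oW _ Wy) => [|i Pi].
  by rewrite big1 // => i Pi; exact: Ff.
exact: Cnat_le wk (FC i Pi).
Qed.

Lemma partialM W f g i y : W y -> Cnat 1 W f -> Cnat 1 W g ->
  partial i (fun z => f z * g z) y = f y * partial i g y + g y * partial i f y.
Proof.
move=> Wy [_ /(_ i)[fd _]] [_ /(_ i)[gd _]]; exact: (deriveM (fd y Wy) (gd y Wy)).
Qed.

(** By induction with the product rule: each term of a derivative of the product
    contains a derivative of [f]. *)
Lemma flatM W k f g y : open W -> W y -> Cnat k W f -> Cnat k W g ->
  flat k f y -> flat k (fun z => f z * g z) y.
Proof.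
move=> oW Wy; elim: k f g => [|k IH] f g fC gC.
  by move=> /flat0 fy; apply/flat0; rewrite fy mul0r.
move=> /flatS[fy ff]; apply/flatS; split=> [|i]; first by rewrite fy mul0r.
have fC1 : Cnat 1 W f by exact: Cnat_le fC.
have gC1 : Cnat 1 W g by exact: Cnat_le gC.
have [_ /(_ i)[_ dfC]] := fC; have [_ /(_ i)[_ dgC]] := gC.
have flf : flat k f y by apply: (@flat_le k k.+1) => //; exact/flatS.
have fg := IH _ _ (Cnat_pred fC) dgC flf.
have gf := IH _ _ dfC (Cnat_pred gC) (ff i).
have C1 := Cnat_mul oW (Cnat_pred fC) dgC.
have C2 := Cnat_mul oW dfC (Cnat_pred gC).
apply: (eq_flat oW Wy _ (flat_lin 1 oW Wy C1 C2 fg gf)).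
by move=> z Wz; rewrite (partialM _ Wz fC1 gC1) mul1r [partial i f z * _]mulrC.
Qed.

(** The chain rule expresses the partial derivatives of [f \o tau] through those
    of [f] composed with [tau]; conclude by induction on [k]. *)
Lemma comp_Cnat k W W' (tau : 'rV[R]_n -> 'rV[R]_n) f : open W -> open W' ->
  (forall y, W y -> W' (tau y)) -> (forall j, Cnat k W (fun z => tau z 0 j)) ->
  (forall y, W y -> {for y, continuous tau}) -> Cnat k W' f ->
  Cnat k W (f \o tau).
Proof.
move=> oW oW' tW tC tc; elim: k f tC => [|k IH] f tC fC.
  by move=> y Wy; apply: continuous_comp; [exact: tc|exact: fC (tW _ Wy)].
have fC1 : Cnat 1 W' f by exact: Cnat_le fC.
have D i y : W y -> is_derive y (delta_mx 0 i) (f \o tau)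
    (\sum_j partial j f (tau y) * partial i (fun z => tau z 0 j) y).
  move=> Wy; apply: (is_derive_comp oW' (tW _ Wy) fC1) => j.
  by have [_ /(_ i)[+ _]] := tC j; apply.
split=> [y Wy|i].
  by apply: continuous_comp; [exact: tc|case: fC => + _; apply; exact: tW].
split=> [y Wy|]; first by case: (D i y Wy).
apply: (eq_Cnat oW (f := fun y => \sum_j partial j f (tau y) * partial i (fun z => tau z 0 j) y)).
  by move=> y Wy; case: (D i y Wy).
apply: Cnat_sum => // j _; apply: Cnat_mul => //.
  apply: IH => [l|]; first exact: Cnat_pred.
  by case: fC => _ /(_ j)[].
by have [_ /(_ i)[]] := tC j.
Qed.

Lemma flat_comp k W W' (tau : 'rV[R]_n -> 'rV[R]_n) f y : open W -> open W' -> W y ->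
  (forall y, W y -> W' (tau y)) -> (forall j, Cnat k W (fun z => tau z 0 j)) ->
  (forall y, W y -> {for y, continuous tau}) -> Cnat k W' f ->
  flat k f (tau y) -> flat k (f \o tau) y.
Proof.
move=> oW oW' Wy tW tC tc; elim: k f tC => [|k IH] f tC fC.
  by move=> /flat0 fy; exact/flat0.
move=> /flatS[fy ff]; apply/flatS; split=> // i.
have fC1 : Cnat 1 W' f by exact: Cnat_le fC.
have tC' j : Cnat k W (fun z => tau z 0 j) by exact: Cnat_pred.
have dtC j : Cnat k W (partial i (fun z => tau z 0 j)) by have [_ /(_ i)[]] := tC j.
have dfC j : Cnat k W' (partial j f) by case: fC => _ /(_ j)[].
pose chain j z := partial j f (tau z) * partial i (fun z => tau z 0 j) z.
apply: (eq_flat (f := fun z => \sum_j chain j z) oW Wy).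
  move=> z Wz; have [|_ //] := @is_derive_comp _ _ W' tau f i z oW' (tW _ Wz) fC1.
  by move=> j; have [_ /(_ i)[+ _]] := tC j; apply.
apply: (flat_sum (F := chain) _ oW Wy) => j _.
  by apply: Cnat_mul => //; exact: (comp_Cnat oW oW' tW tC' tc).
apply: (@flatM W _ (fun z => partial j f (tau z)) (partial i (fun z => tau z 0 j))) => //.
  exact: (comp_Cnat oW oW' tW tC' tc).
exact: IH.
Qed.

(** Integrating a bound on the partial derivatives, by [box_mean_value], gains
    one power of [`|z - y|]. *)
Lemma flat_small k W f y (e : R) : open W -> W y -> Cnat k W f -> flat k f y ->
  0 < e -> \forall z \near y, `|f z| <= e * `|z - y| ^+ k.
Proof.
move=> oW Wy; elim: k f e => [|k IH] f e fC.
  move=> /flat0 fy e0; apply: filterS (near_le_of_continuous (fC _ Wy) e0) => z.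
  by rewrite fy subr0 expr0 mulr1.
move=> /flatS[fy ff] e0.
have e'0 : 0 < e / n.+1%:R by rewrite divr_gt0.
have H i : \forall z \near y, `|partial i f z| <= e / n.+1%:R * `|z - y| ^+ k.
  by apply: IH => //; case: fC => _ /(_ i)[].
have H1 : \forall z \near y, forall i, `|partial i f z| <= e / n.+1%:R * `|z - y| ^+ k.
  exact: (@filter_forall _ _ (fun i z => `|partial i f z| <= e / n.+1%:R * `|z - y| ^+ k)
    (nbhs y) (nbhs_filter y)).
have H2 : \forall z \near y, W z by exact: open_nbhs_nbhs.
have [r r0 rP] := near_box (filterI H1 H2).
apply: (box_near r0) => z zr.
have M0 : 0 <= e / n.+1%:R * `|z - y| ^+ k by rewrite mulr_ge0 // ltW.
have := @box_mean_value _ _ f y _ `|z - y| M0 _ _ z (lexx _).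
rewrite fy subr0 => /(_ _ _)/le_trans; apply.
- move=> u uz i; have [_ Wu] := rP u (le_trans uz zr).
  by case: fC => _ /(_ i)[+ _]; apply.
- move=> u uz i; have [/(_ i)/le_trans + _] := rP u (le_trans uz zr); apply.
  by rewrite ler_pM2l // lerXn2r // nnegrE.
- rewrite exprSr !mulrA; apply: ler_wpM2r => //; apply: ler_wpM2r; first exact: exprn_ge0.
  by rewrite -mulrA mulrCA ger_pMr // ler_pdivrMr // mul1r ler_nat.
Qed.

End Flatness.

(** * Monomials and Taylor polynomials *)

Section Monomials.
Context {R : realType} {n : nat}.
Implicit Types (f g : 'rV[R]_n -> R) (x y z : 'rV[R]_n) (W : set 'rV[R]_n)
  (w : seq 'I_n) (a b : 'I_n -> nat).

Definition word a := flatten [seq nseq (a i) i | i <- enum 'I_n].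

Lemma pderivE a f : pderiv a f = wder (word a) f.
Proof.
rewrite /pderiv /word; elim: (enum _) => //= i s ->; rewrite wder_cat.
by elim: (a i) => //= k ->.
Qed.

Lemma size_word a : size (word a) = mdeg a.
Proof.
rewrite size_flatten /shape -map_comp sumnE big_map /mdeg -big_enum /=.
by apply: eq_bigr => i _; rewrite /= size_nseq.
Qed.

Lemma count_word a i : count_mem i (word a) = a i.
Proof.
rewrite count_flatten -map_comp sumnE big_map big_enum (bigD1 i) //= count_nseq /= eqxx mul1n.
by rewrite big1 ?addn0 // => j ji; rewrite count_nseq /= (negbTE ji).
Qed.

Lemma perm_word w : perm_eq w (word (fun i => count_mem i w)).
Proof. by apply/allP => i _ /=; rewrite count_word. Qed.

Lemma mdeg_count w : mdeg (fun i => count_mem i w) = size w.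
Proof. by rewrite -size_word -(perm_size (perm_word w)). Qed.

Lemma leq_mdeg a i : (a i <= mdeg a)%N.
Proof. by rewrite /mdeg (bigD1 i) //= leq_addr. Qed.

(** Faithful when [mdeg a <= k], by [mindex_ofE]; an entry larger than [k] is
    sent to the default value 0. *)
Definition mindex_of (k : nat) a : mindex (n := n) k := [ffun i => inord (a i)].

Lemma mindex_ofE k a : (mdeg a <= k)%N -> (fun i => mindex_of k a i : nat) = a.
Proof.
move=> ak; apply/funext => i; rewrite ffunE inordK // ltnS.
exact: leq_trans (leq_mdeg a i) ak.
Qed.

Lemma flat_pderivP W k f y : open W -> W y -> Cnat k W f ->
  flat k f y <-> forall a : mindex k, (mdeg (fun i => a i) <= k)%N ->
    pderiv (fun i => a i) f y = 0.
Proof.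
move=> oW Wy fC; split=> [ff a ak|ff w wk].
  by rewrite pderivE; apply: ff; rewrite size_word.
rewrite (wder_perm oW fC wk (perm_word w) Wy) -pderivE.
have ak : (mdeg (fun i => count_mem i w) <= k)%N by rewrite mdeg_count.
by have := ff (mindex_of k (fun i => count_mem i w)); rewrite mindex_ofE //; apply.
Qed.

(** The monomial [(z - x)^a]. *)
Definition mono x a z := \prod_i (z 0 i - x 0 i) ^+ a i.

Definition monoD a i (k : nat) : 'I_n -> nat := fun j => (a j - (j == i) * k)%N.

Lemma is_derive_shift_pow (c D : R) k : is_derive (0 : R) (1 : R)
  (fun s : R => (s + c) ^+ k * D) (c ^+ k.-1 *+ k * D).
Proof.
have H := is_deriveM (is_deriveX k (is_derive_shift (0 : R) (1 : R) c))
  (is_derive_cst D (0 : R) (1 : R)).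
rewrite (_ : (fun s => _) = (shift c ^+ k * cst D)); last by apply/funext => s; rewrite !fctE.
apply: is_derive_eq H _; rewrite scaler0 add0r /= add0r.
by rewrite [_ *: 1]mulr1 mulr_natl [LHS]mulrC.
Qed.

Lemma is_derive_mono x a i z : is_derive z (delta_mx 0 i) (mono x a)
  ((a i)%:R * mono x (monoD a i 1) z).
Proof.
pose D := \prod_(j | j != i) (z 0 j - x 0 j) ^+ a j.
pose c := z 0 i - x 0 i.
apply: is_derive_of_line.
rewrite (_ : (fun s => _) = (fun s : R => (s + c) ^+ a i * D)); last first.
  apply/funext => s; rewrite /mono (bigD1 i) //= !mxE !eqxx mulr1 /c addrA.
  congr (_ * _); apply: eq_bigr => j ji.
  by rewrite !mxE eqxx (negbTE ji) mulr0 add0r.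
have -> : (a i)%:R * mono x (monoD a i 1) z = (c ^+ (a i).-1 *+ a i) * D.
  rewrite /mono (bigD1 i) //= mulrA /monoD eqxx mul1n subn1 mulr_natl; congr (_ * _).
  by apply: eq_bigr => j ji; rewrite (negbTE ji) subn0.
exact: is_derive_shift_pow.
Qed.

Lemma partial_mono x a i : partial i (mono x a) = (fun z => (a i)%:R * mono x (monoD a i 1) z).
Proof. by apply/funext => z; case: (is_derive_mono x a i z). Qed.

Lemma Cnat_mono k W x a : open W -> Cnat k W (mono x a).
Proof.
move=> oW; elim: k a => [|k IH] a.
  move=> y Wy; apply: (@continuous_big _ _ _ _ _ (@mul_continuous R)) => i _ z.
  apply: (@continuous_comp _ _ _ (fun z : 'rV[R]_n => z 0 i - x 0 i) (fun t : R => t ^+ a i)).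
    exact: (cvgB (@coord_continuous R 1 n 0 i z) (cvg_cst _)).
  exact: exprn_continuous.
split=> [y Wy|i].
  by have := IH a; move/Cnat_cont; apply.
split=> [y Wy|]; first by case: (is_derive_mono x a i y).
rewrite partial_mono; have C0 : Cnat k W (fun=> 0 : R) by exact: Cnat_cst.
by apply: (eq_Cnat oW _ (Cnat_lin (a i)%:R oW (IH (monoD a i 1)) C0)) => y _; rewrite addr0.
Qed.

Lemma partialZ W (c : R) f i : open W -> Cnat 1 W f -> forall y, W y ->
  partial i (fun z => c * f z) y = c * partial i f y.
Proof.
by move=> oW [_ /(_ i)[fd _]] y Wy; exact: (deriveZ c (fd y Wy)).
Qed.

Lemma iter_partial_mono x a i k (c : R) :
  iter k (partial i) (fun z => c * mono x a z) =
  (fun z => c * (a i ^_ k)%:R * mono x (monoD a i k) z).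
Proof.
elim: k => [|k IH] /=.
  apply/funext => z; rewrite ffactn0 mulr1; congr (_ * mono x _ z).
  by apply/funext => j; rewrite /monoD muln0 subn0.
rewrite IH; apply/funext => z.
rewrite (partialZ _ _ openT (Cnat_mono 1 x _ openT)) // partial_mono !mulrA.
rewrite -(mulrA c) -natrM ffactnSr /monoD eqxx mul1n; congr (_ * mono x _ z).
by apply/funext => j; rewrite -subnDA -mulnDr addn1.
Qed.

(** Since subtraction is truncated, the monomial on the right is only the
    expected one if [b <= a]; otherwise the falling factorials vanish. *)
Lemma pderiv_mono x a b : pderiv b (mono x a) =
  (fun z => (\prod_i (a i ^_ b i)%:R) * mono x (fun i => a i - b i)%N z).
Proof.
rewrite /pderiv -big_enum /=.
have -> : (fun i => a i - b i)%N = (fun i => a i - (i \in enum 'I_n) * b i)%N.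
  by apply/funext => i; rewrite mem_enum mul1n.
elim: (enum _) (enum_uniq 'I_n) => [_|i s IH] /=.
  apply/funext => z; rewrite big_nil mul1r; congr (mono x _ z).
  by apply/funext => j; rewrite subn0.
move=> /andP[si us]; rewrite IH // iter_partial_mono (negbTE si) mul0n subn0.
apply/funext => z; rewrite big_cons [(a i ^_ b i)%:R * _]mulrC; congr (_ * mono x _ z).
apply/funext => j; rewrite /monoD in_cons; have [->|ji] /= := eqVneq j i.
  by rewrite (negbTE si) mul0n subn0 .
by rewrite mul0n subn0.
Qed.

Definition afact a : R := (\prod_i (a i)`!)%:R.

Lemma afact_neq0 a : afact a != 0.
Proof. by rewrite pnatr_eq0 -lt0n prodn_gt0 // => i; exact: fact_gt0. Qed.

Lemma mono_center x a : mono x a x = [forall i, a i == 0%N]%:R.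
Proof.
rewrite /mono; case: forallP => [a0|na].
  by rewrite big1 // => i _; rewrite (eqP (a0 i)) expr0.
have [i ai] : exists i, a i != 0%N.
  by apply/existsP; rewrite -negb_forall; apply/forallP.
by rewrite (bigD1 i) //= subrr expr0n (negbTE ai) mul0r.
Qed.

Lemma pderiv_mono_center k x (a b : mindex (n := n) k) :
  pderiv (fun i => b i) (mono x (fun i => a i)) x = if a == b then afact (fun i => b i) else 0.
Proof.
rewrite pderiv_mono mono_center; case: eqVneq => [->|ab].
  rewrite (_ : [forall i, _]); last by apply/forallP => i; rewrite subnn.
  by rewrite mulr1 /afact natr_prod; apply: eq_bigr => i _; rewrite ffactnn.
case: forallP => [H|_]; last by rewrite mulr0.
have [i ai] : exists i, a i != b i.
  apply/existsP; rewrite -negb_forall; apply: contra ab => /forallP ab.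
  by apply/eqP/ffunP => i; exact/eqP.
rewrite (bigD1 i) //= ffact_small ?mul0r // ltn_neqAle -subn_eq0 (H i) andbT.
by rewrite val_eqE.
Qed.

Definition taylor_poly k f x z := \sum_(a : mindex (n := n) k | (mdeg (fun i => a i) <= k)%N)
  (pderiv (fun i => a i) f x / afact (fun i => a i)) * mono x (fun i => a i) z.

Lemma CnatZ k W (c : R) f : open W -> Cnat k W f -> Cnat k W (fun z => c * f z).
Proof.
move=> oW fC; have C0 : Cnat k W (fun=> 0 : R) by exact: Cnat_cst.
by apply: (eq_Cnat oW _ (Cnat_lin c oW fC C0)) => y _; rewrite addr0.
Qed.

Lemma pderivZ W a (c : R) f : open W -> Cnat (mdeg a) W f -> forall y, W y ->
  pderiv a (fun z => c * f z) y = c * pderiv a f y.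
Proof.
by move=> oW fC y Wy; rewrite -size_word in fC; rewrite !pderivE; exact: wderZ fC _ Wy.
Qed.

Lemma pderiv_sum W a (I : Type) (s : seq I) (P : pred I) (F : I -> 'rV[R]_n -> R) :
  open W -> (forall i, P i -> Cnat (mdeg a) W (F i)) -> forall y, W y ->
  pderiv a (fun z => \sum_(i <- s | P i) F i z) y = \sum_(i <- s | P i) pderiv a (F i) y.
Proof.
move=> oW FC y Wy; rewrite pderivE (wder_sum s oW _ Wy) ?size_word //.
by apply: eq_bigr => i _; rewrite pderivE.
Qed.

Lemma Cnat_taylor_poly l W k f x : open W -> Cnat l W (taylor_poly k f x).
Proof.
by move=> oW; apply: Cnat_sum => // a _; apply: CnatZ => //; exact: Cnat_mono.
Qed.

(** The coefficients of a polynomial are recovered from its derivatives at the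
    center. *)
Lemma pderiv_sum_mono x k (c : mindex (n := n) k -> R) (P : pred (mindex (n := n) k))
    (b : mindex (n := n) k) : P b ->
  pderiv (fun i => b i) (fun z => \sum_(a | P a) c a * mono x (fun i => a i) z) x
    = c b * afact (fun i => b i).
Proof.
have monoC l a : Cnat l setT (mono x a) by apply: Cnat_mono; exact: openT.
move=> Pb; rewrite (pderiv_sum _ openT) // => [|a _]; last by apply: CnatZ => //; exact: openT.
rewrite (bigD1 b) //= (pderivZ _ openT) //.
rewrite pderiv_mono_center eqxx big1 ?addr0 // => a /andP[_ ab].
by rewrite (pderivZ _ openT) // pderiv_mono_center (negbTE ab) mulr0.
Qed.

(** Stated for [-1 * taylor_poly + f] because sheaf morphisms are linear in this
    form. *)
Lemma flat_taylor_poly W k f x : open W -> W x -> Cnat k W f ->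
  flat k (fun z => -1 * taylor_poly k f x z + f z) x.
Proof.
move=> oW Wx fC; apply/(flat_pderivP oW Wx).
  by apply: Cnat_lin => //; exact: Cnat_taylor_poly.
move=> b bk; rewrite pderivE.
have fb : Cnat (size (word (fun i => b i))) W f by rewrite size_word; exact: Cnat_le fC.
rewrite (wder_lin (-1) oW _ fb Wx); last exact: Cnat_taylor_poly.
rewrite -!pderivE pderiv_sum_mono //.
by rewrite divfK ?afact_neq0 // mulN1r addNr.
Qed.

Lemma eq_pderiv_flat W k f g y a : open W -> W y -> Cnat k W f -> Cnat k W g ->
  (mdeg a <= k)%N -> flat k (fun z => -1 * f z + g z) y -> pderiv a f y = pderiv a g y.
Proof.
move=> oW Wy fC gC ak fl; rewrite !pderivE; apply/esym/eqP; rewrite -subr_eq0 addrC -mulN1r.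
rewrite -(wder_lin (-1) oW _ _ Wy) ?size_word; [|exact: Cnat_le fC|exact: Cnat_le gC].
by rewrite fl // size_word.
Qed.

(** Expanding in powers of [z] with coefficients polynomial in [x] separates the
    variables, so that an operator acting on [z] can be applied term by term
    while [x] varies. *)
Lemma mono_expand m x a z : (mdeg a <= m)%N -> mono x a z =
  \sum_(b : mindex (n := n) m) (\prod_i ((-1) ^+ (a i - b i) *+ 'C(a i, b i)))
    * mono 0 (fun i => a i - b i)%N x * mono 0 (fun i => b i) z.
Proof.
move=> am.
have -> : mono x a z = \prod_i \sum_(j < m.+1)
    (-1) ^+ (a i - j) *+ 'C(a i, j) * x 0 i ^+ (a i - j) * z 0 i ^+ j.
  apply: eq_bigr => i _; rewrite addrC exprDn.
  have aim : ((a i).+1 <= m.+1)%N by rewrite ltnS (leq_trans (leq_mdeg a i)).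
  rewrite (big_ord_widen _ (fun j => (- x 0 i) ^+ (a i - j) * z 0 i ^+ j *+ 'C(a i, j)) aim).
  rewrite big_mkcond; apply: eq_bigr => j _; case: ifP => ji.
    by rewrite (exprNn (x 0 i)) !mulrnAl.
  by rewrite bin_small ?mulr0n ?mul0r // ltnNge -ltnS ji.
rewrite bigA_distr_bigA; apply: eq_bigr => b _; rewrite !big_split /=.
by congr (_ * _ * _); apply: eq_bigr => i _; rewrite mxE subr0.
Qed.

End Monomials.

(** * Powers of the positive part of an affine form *)

Lemma is_derive_small {R : realType} {V : normedModType R} (F : V -> R) (x v : V) :
  F x = 0 -> (forall e : R, 0 < e -> \forall z \near x, `|F z| <= e * `|z - x|) ->
  is_derive x v F 0.
Proof.
move=> Fx Fs.
have L : (fun h => h^-1 *: (F (h *: v + x) - F x)) @ 0^' --> (0 : R).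
  apply/cvgrPdist_le => e e0.
  have e'0 : 0 < e / (`|v| + 1) by rewrite divr_gt0 // ltr_wpDl.
  have c : (fun h : R => h *: v + x) @ 0 --> x.
    rewrite -[X in _ --> X]add0r -[X in _ --> X + _](scale0r v).
    by apply: cvgD; [apply: cvgZr_tmp; exact: cvg_id|exact: cvg_cst].
  have H : \forall h \near (0 : R), `|F (h *: v + x)| <= e / (`|v| + 1) * `|h *: v + x - x|.
    exact: (c _ (Fs _ e'0)).
  apply/nbhs_ballP; have /nbhs_ballP[r /= r0 rP] := H; exists r => //= h hr h0.
  rewrite sub0r normrN Fx subr0 normrM normfV.
  have := rP h hr; rewrite addrK normrZ => Fh.
  rewrite mulrC ler_pdivrMr ?normr_gt0 //; apply: le_trans Fh _.
  rewrite mulrCA mulrC; apply: ler_wpM2r => //.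
  rewrite -mulrA ger_pMr // mulrC ler_pdivrMr ?mul1r ?ltr_wpDl //.
  by rewrite lerDl.
by apply: DeriveDef; [apply/cvg_ex; exists 0|apply: cvg_lim].
Qed.

Section PositivePart.
Context {R : realType} {n : nat}.
Implicit Types (f g : 'rV[R]_n -> R) (x y z xi : 'rV[R]_n) (W : set 'rV[R]_n)
  (w : seq 'I_n) (a b : 'I_n -> nat).

Definition pospow k (t : R) : R := Num.max 0 t ^+ k.

Lemma pospow_pos k t : 0 <= t -> pospow k t = t ^+ k.
Proof. by move=> t0; rewrite /pospow max_r. Qed.

Lemma pospow_neg k t : t <= 0 -> pospow k.+1 t = 0.
Proof. by move=> t0; rewrite /pospow max_l // expr0n. Qed.

Lemma is_derive_pospow k (t : R) : is_derive t (1 : R) (pospow k.+2) (pospow k.+1 t *+ k.+2).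
Proof.
have [t0|t0|->] := ltgtP t 0.
- rewrite pospow_neg ?ltW // mul0rn.
  apply: near_eq_is_derive (is_derive_cst (0 : R) t (1 : R)).
  have := lt_nbhsl t0; apply: filterS => s s0 /=.
  by rewrite pospow_neg // ltW.
- rewrite pospow_pos ?ltW //.
  have H : is_derive t (1 : R) ((id : R -> R) ^+ k.+2) (t ^+ k.+1 *+ k.+2).
    by apply: is_derive_eq; rewrite [_ *: 1]mulr1 mulr_natl.
  apply: near_eq_is_derive H.
  have := lt_nbhsr t0; apply: filterS => s s0 /=.
  by rewrite (pospow_pos _ (ltW s0)) !fctE.
- rewrite pospow_neg // mul0rn; apply: is_derive_small; first exact: pospow_neg.
  move=> e e0; apply/nbhs_ballP; exists (Num.min 1 e); first by rewrite /= lt_min ltr01.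
  move=> s; rewrite /ball /= sub0r normrN lt_min subr0 => /andP[s1 se].
  have [s0|s0] := leP s 0; first by rewrite pospow_neg // normr0 mulr_ge0 // (ltW e0).
  rewrite (pospow_pos _ (ltW s0)) exprSr normrM; apply: ler_wpM2r => //.
  rewrite exprSr normrM (le_trans _ (ltW se)) // ler_piMl // normrX.
  by apply: exprn_ile1 => //; exact: ltW.
Qed.

Definition dot xi (v : 'rV[R]_n) : R := \sum_j xi 0 j * v 0 j.

(** For [xi != 0] this function is of class C^l for l < k only, its singularities
    being on the hyperplane through [x] orthogonal to [xi]. *)
Definition ridge xi x k z : R := pospow k (dot xi (z - x)).

Lemma dotZr xi (t : R) (v : 'rV[R]_n) : dot xi (t *: v) = t * dot xi v.
Proof. by rewrite /dot mulr_sumr; apply: eq_bigr => j _; rewrite mxE mulrCA. Qed.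

Lemma dotDr xi (u v : 'rV[R]_n) : dot xi (u + v) = dot xi u + dot xi v.
Proof. by rewrite /dot -big_split; apply: eq_bigr => j _; rewrite mxE mulrDr. Qed.

Lemma dot_delta xi i : dot xi (delta_mx 0 i) = xi 0 i.
Proof.
rewrite /dot (bigD1 i) //= mxE !eqxx mulr1 big1 ?addr0 // => j ji.
by rewrite mxE (negbTE ji) mulr0.
Qed.

Lemma dot_continuous xi x : continuous (fun z => dot xi (z - x)).
Proof.
move=> z; apply: (@continuous_big _ _ _ _ _ (@add_continuous R)) => i _ {}z.
have shiftc : {for z, continuous (fun z : 'rV[R]_n => (z - x) 0 i)}.
  apply: (@continuous_comp _ _ _ (fun z : 'rV[R]_n => z - x) (fun u : 'rV[R]_n => u 0 i)).
    exact: (cvgB cvg_id (cvg_cst _)).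
  exact: coord_continuous.
exact: (cvgM (cvg_cst (xi 0 i)) shiftc).
Qed.

Lemma dot_pow_continuous xi x k : continuous (fun z => dot xi (z - x) ^+ k).
Proof.
elim: k => [|k IH] z; first exact: cst_continuous.
rewrite (_ : (fun z => _) = (fun z => dot xi (z - x) * dot xi (z - x) ^+ k)).
  exact: (cvgM (dot_continuous (x0 := z)) (IH z)).
by apply/funext => u; rewrite exprS.
Qed.

Lemma pospow_continuous k : continuous (pospow k).
Proof.
move=> t; apply: (@continuous_comp _ _ _ (fun t : R => Num.max 0 t) (fun t : R => t ^+ k)).
  by apply: continuous_max; [exact: cst_continuous|exact: cvg_id].
exact: exprn_continuous.
Qed.

Lemma ridge_continuous xi x k : continuous (ridge xi x k).
Proof.
move=> z; apply: (@continuous_comp _ _ _ (fun z => dot xi (z - x)) (pospow k)).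
  exact: dot_continuous.
exact: pospow_continuous.
Qed.

Lemma is_derive_ridge xi x k i z : is_derive z (delta_mx 0 i) (ridge xi x k.+2)
  (xi 0 i * k.+2%:R * ridge xi x k.+1 z).
Proof.
apply: is_derive_of_line.
pose c := dot xi (z - x).
rewrite (_ : (fun s => _) = pospow k.+2 \o (fun s : R => s * xi 0 i + c)); last first.
  by apply/funext => s; rewrite /ridge /= -addrA dotDr dotZr dot_delta.
have d1 : is_derive (0 : R) (1 : R) (fun s : R => s * xi 0 i + c) (xi 0 i).
  by apply: is_derive_eq; rewrite addr0 scaler0 add0r [_%:A]mulr1.
have H := @is_derive1_comp _ (pospow k.+2) (fun s : R => s * xi 0 i + c) 0 _ _
  (is_derive_pospow k _) d1.
by apply: is_derive_eq H _; rewrite mul0r add0r mulrC -mulrA mulr_natl.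
Qed.

Lemma partial_ridge xi x k i :
  partial i (ridge xi x k.+2) = (fun z => xi 0 i * k.+2%:R * ridge xi x k.+1 z).
Proof. by apply/funext => z; case: (is_derive_ridge xi x k i z). Qed.

Lemma Cnat_ridge k W xi x : open W -> Cnat k W (ridge xi x k.+1).
Proof.
move=> oW; elim: k => [|k IH]; first by move=> y _; exact: ridge_continuous.
split=> [y _|i]; first exact: ridge_continuous.
split=> [y _|]; first by case: (is_derive_ridge xi x k i y).
by rewrite partial_ridge; exact: CnatZ.
Qed.

Lemma wder_ridge xi x w k : wder w (ridge xi x (size w + k).+1) =
  (fun z => ((size w + k).+1 ^_ (size w))%:R * (\prod_(i <- w) xi 0 i) * ridge xi x k.+1 z).
Proof.
elim/last_ind: w k => [|w i IH] k.
  by apply/funext => z; rewrite /= add0n big_nil ffactn0 !mul1r.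
rewrite wder_rcons size_rcons addSn partial_ridge; apply/funext => z.
rewrite (wderZ _ openT) //; last first.
  by apply: (Cnat_le _ (Cnat_ridge _ _ _ openT)); exact: leq_addr.
rewrite IH ffactSS big_rcons /= natrM.
have swap (p q s t u : R) : p * q * (s * t * u) = q * s * (t * p) * u by ring.
exact: swap.
Qed.

Lemma prod_word a xi : \prod_(i <- word a) xi 0 i = mono 0 a xi.
Proof.
rewrite big_flatten big_map big_enum /=; apply: eq_bigr => i _.
by rewrite big_nseq mxE subr0 iter_mulr_1.
Qed.

Lemma pderiv_ridge a k xi x z : pderiv a (ridge xi x (mdeg a + k).+1) z =
  ((mdeg a + k).+1 ^_ (mdeg a))%:R * mono 0 a xi * ridge xi x k.+1 z.
Proof. by rewrite pderivE -size_word wder_ridge prod_word. Qed.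

End PositivePart.

(** * Gluing a flat function with a homogeneous one *)

Section Homogeneous.
Context {R : realType} {n : nat}.
Implicit Types (f g : 'rV[R]_n -> R) (x y z xi v : 'rV[R]_n) (W : set 'rV[R]_n)
  (w : seq 'I_n).

(** Homogeneity of degree [- j] with respect to the center [x]. *)
Definition homog x (j : nat) g := forall (t : R) v, 0 < t -> v != 0 ->
  t ^+ j * g (t *: v + x) = g (v + x).

Lemma open_neq x : open [set~ x].
Proof.
rewrite openC; apply: accessible_closed_set1; apply: hausdorff_accessible.
exact: norm_hausdorff.
Qed.

(** Compactness of the unit sphere. *)
Lemma homog_bounded x j g : (forall y, y != x -> {for y, continuous g}) ->
  homog x j g -> exists2 C, 0 <= C & forall y, y != x -> `|g y| * `|y - x| ^+ j <= C.
Proof.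
move=> gc gh; pose S := [set v : 'rV[R]_n | `|v| = 1].
have unit_in y : y != x -> S (`|y - x|^-1 *: (y - x)).
  by move=> yx; rewrite /S /= normrZ normfV normr_id mulVf // normr_eq0 subr_eq0.
have [S0|/set0P S0] := eqVneq S set0.
  by exists 0 => // y /unit_in; rewrite S0.
have Sc : compact S.
  apply: bounded_closed_compact.
    by exists 1; split=> // M M1 v /= ->; exact: ltW.
  apply: (@closed_comp _ _ (fun v : 'rV[R]_n => `|v|) [set 1]).
    by move=> v _; exact: norm_continuous.
  exact: closed_eq.
have [|v vS vM] := @EVT_max_rV R n (fun v => `|g (v + x)|) S S0 Sc.
  apply: continuous_in_subspaceT => v; rewrite inE => v1.
  have vx : v + x != x.
    by rewrite -subr_eq0 addrK -normr_eq0 v1 oner_eq0.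
  apply: (@continuous_comp _ _ _ (fun v => g (v + x)) (fun t : R => `|t|)); last first.
    exact: norm_continuous.
  apply: (@continuous_comp _ _ _ (fun v => v + x) g); last exact: gc.
  exact: (cvgD cvg_id (cvg_cst _)).
exists `|g (v + x)| => // y yx.
have t0 : 0 < `|y - x| by rewrite normr_gt0 subr_eq0.
have := vM (`|y - x|^-1 *: (y - x)); rewrite inE => /(_ (unit_in _ yx)).
apply: le_trans.
rewrite -(gh `|y - x| _ t0); last by rewrite scaler_eq0 invr_eq0 normr_eq0 orbb subr_eq0.
rewrite scalerA mulfV ?gt_eqF // scale1r subrK normrM mulrC.
by rewrite normrX normr_id.
Qed.

Lemma homog_partial x j g i : (forall y, y != x -> derivable g y (delta_mx 0 i)) ->
  homog x j g -> homog x j.+1 (partial i g).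
Proof.
move=> gd gh t v t0 v0.
have vx : v + x != x by rewrite -subr_eq0 addrK.
have tvx : t *: v + x != x by rewrite -subr_eq0 addrK scaler_eq0 negb_or gt_eqF.
have d1 : is_derive (0 : R) (1 : R) (fun s : R => s * t) t.
  by apply: is_derive_eq; rewrite scaler0 add0r [_%:A]mulr1.
pose gline z (s : R) := g (s *: delta_mx 0 i + z).
have d2 : is_derive (0 * t) (1 : R) (gline (t *: v + x)) (partial i g (t *: v + x)).
  by apply: is_derive_line; rewrite mul0r scale0r add0r; apply: derivableP; exact: gd.
have d3 := @is_derive1_comp _ _ _ 0 _ _ d2 d1.
have d4 : is_derive (0 : R) (1 : R) (gline (v + x)) (partial i g (v + x)).
  by apply: is_derive_line; rewrite scale0r add0r; apply: derivableP; exact: gd.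
have d5 := is_deriveZ (t ^+ j) d3.
have E : \forall s \near (0 : R),
    (t ^+ j \*: (gline (t *: v + x) \o (fun s : R => s * t))) s = gline (v + x) s.
  apply/nbhs_ballP; exists `|v|; first by rewrite /= normr_gt0.
  move=> s; rewrite /ball /= sub0r normrN => sv.
  rewrite [LHS](_ : _ = t ^+ j * g (t *: (s *: delta_mx 0 i + v) + x)).
    rewrite gh /gline ?addrA //; apply: contraTneq sv => /eqP; rewrite addr_eq0 => /eqP sv.
    rewrite -leNgt -(normrN v) -sv normrZ; apply: ler_piMr => //; exact: norm_delta_le1.
  by rewrite /gline /= scalerDr scalerA mulrC addrA.
have [_ d6] := near_eq_is_derive E d5; have [_ d7] := d4.
rewrite -d7 d6 exprSr -mulrA; congr (_ * _); exact: mulrC.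
Qed.

End Homogeneous.

Section Glue.
Context {R : realType} {n : nat}.
Implicit Types (f g h : 'rV[R]_n -> R) (x y z xi v : 'rV[R]_n) (W : set 'rV[R]_n).

Definition glue x h : 'rV[R]_n -> R := fun z => if z == x then 0 else h z.

Lemma glue_neq x h z : z != x -> glue x h z = h z.
Proof. by rewrite /glue => /negbTE ->. Qed.

Lemma glue_center x h : glue x h x = 0.
Proof. by rewrite /glue eqxx. Qed.

(** The growth of order [- j] of [g] is absorbed by the flatness of order
    [k + j] of [f]. *)
Lemma glue_small W k j f g x (e : R) : open W -> W x -> Cnat (k + j) W f ->
  flat (k + j) f x -> (forall y, y != x -> {for y, continuous g}) -> homog x j g ->
  0 < e -> \forall z \near x, `|glue x (fun z => f z * g z) z| <= e * `|z - x| ^+ k.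
Proof.
move=> oW Wx fC ff gc gh e0.
have [C C0 CP] := homog_bounded gc gh.
have C10 : 0 < C + 1 by rewrite ltr_wpDl.
have e'0 : 0 < e / (C + 1) by rewrite divr_gt0.
apply: filterS (flat_small oW Wx fC ff e'0) => z fz.
have [->|zx] := eqVneq z x.
  by rewrite glue_center normr0 mulr_ge0 ?exprn_ge0 // ltW.
rewrite glue_neq // normrM; apply: (@le_trans _ _ (e / (C + 1) * `|z - x| ^+ (k + j) * `|g z|)).
  exact: ler_wpM2r.
rewrite exprD -!mulrA; apply: ler_wpM2l; first exact: ltW.
rewrite mulrCA; apply: ler_piMr; first exact: exprn_ge0.
rewrite mulrC ler_pdivrMr // mul1r mulrC (le_trans (CP _ zx)) //.
by rewrite lerDl.
Qed.

Lemma glue_continuous W j f g x : open W -> W x -> Cnat j W f -> flat j f x ->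
  (forall y, y != x -> {for y, continuous g}) -> homog x j g ->
  forall y, W y -> {for y, continuous (glue x (fun z => f z * g z))}.
Proof.
move=> oW Wx fC ff gc gh y Wy; have [->|yx] := eqVneq y x.
  apply: continuous_of_near_le => e e0; rewrite glue_center.
  have H := @glue_small W 0 j f g x e oW Wx fC ff gc gh e0.
  by apply: filterS H => z; rewrite subr0 expr0 mulr1.
have oW0 : open (W `&` [set~ x]) by apply: openI => //; exact: open_neq.
apply: (eq_continuous_for oW0 (f := fun z => f z * g z)) => [|z [_ /eqP zx]|].
- by split=> //; exact/eqP.
- by rewrite glue_neq.
- exact: (cvgM (Cnat_cont fC Wy) (gc y yx)).
Qed.

(** The statement is set up for an induction on [k]: in the derivative
    [f * partial i g + partial i f * g] of the glued function, one more
    derivative of [g] costs one degree of homogeneity ([homog_partial]), that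
    is, [k] decreases and [j] increases, while a derivative of [f] costs one
    order of flatness. At [x] the derivative is 0 by [glue_small]. *)
Lemma glue_Cnat W k j f g x : open W -> W x -> Cnat (k + j) W f ->
  flat (k + j) f x -> Cnat k [set~ x] g -> homog x j g ->
  Cnat k W (glue x (fun z => f z * g z)).
Proof.
move=> oW Wx.
have oX : open [set~ x] by exact: open_neq.
have oW0 : open (W `&` [set~ x]) by exact: openI.
elim: k j f g => [|k IH] j f g fC ff gC gh;
  have gc y (yx : y != x) : {for y, continuous g} := Cnat_cont gC (elimN eqP yx).
  exact: (glue_continuous oW Wx fC ff gc gh).
have fC1 : Cnat 1 W f by apply: Cnat_le fC; rewrite addSn.
have gC1 : Cnat 1 [set~ x] g by exact: Cnat_le gC.
have dg i y : y != x -> derivable g y (delta_mx 0 i).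
  by move=> /eqP yx; have [_ /(_ i)[+ _]] := gC; apply.
have HE y : (W `&` [set~ x]) y -> f y * g y = glue x (fun z => f z * g z) y.
  by move=> [_ /eqP yx]; rewrite glue_neq.
have D i y : W y -> is_derive y (delta_mx 0 i) (glue x (fun z => f z * g z))
    (glue x (fun z => f z * partial i g z) y + glue x (fun z => partial i f z * g z) y).
  move=> Wy; have [->|yx] := eqVneq y x.
    rewrite !glue_center addr0; apply: is_derive_small; first exact: glue_center.
    move=> e e0.
    have H := @glue_small W 1 j f g x e oW Wx _ _ gc gh e0.
    apply: (filterS _ (H _ _)); first by move=> z; rewrite expr1.
      by apply: Cnat_le fC; rewrite addSn ltnS leq_addl.
    by apply: flat_le ff; rewrite addSn ltnS leq_addl.
  have W0y : (W `&` [set~ x]) y by split=> //; exact/eqP.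
  apply: (near_eq_is_derive (near_open oW0 W0y HE)).
  rewrite !glue_neq // [partial i f y * _]mulrC.
  have [_ /(_ i)[fd _]] := fC.
  exact: (is_deriveM (derivableP (fd y Wy)) (derivableP (dg i y yx))).
split=> [y Wy|i].
  exact: (glue_continuous oW Wx (Cnat_le (leq_addl _ _) fC) (flat_le (leq_addl _ _) ff) gc gh Wy).
split=> [y Wy|]; first by case: (D i y Wy).
have [_ /(_ i)[_ dfC]] := fC.
have C1 : Cnat k W (glue x (fun z => f z * partial i g z)).
  apply: (IH j.+1); rewrite ?addnS -?addSn //.
    by case: gC => _ /(_ i)[].
  by apply: homog_partial gh => y; exact: dg.
have C2 : Cnat k W (glue x (fun z => partial i f z * g z)).
  apply: (IH j) => //; last exact: Cnat_pred.
  by move: ff; rewrite addSn => /flatS[_]; apply.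
apply: (eq_Cnat oW _ (Cnat_lin 1 oW C1 C2)) => y Wy.
by rewrite mul1r; case: (D i y Wy).
Qed.

End Glue.

(** * A cutoff function along two opposite cones *)

Section Cutoff.
Context {R : realType} {n : nat}.
Implicit Types (f g h : 'rV[R]_n -> R) (x y z xi v : 'rV[R]_n) (W : set 'rV[R]_n).

Lemma Cnat_inv k W g : open W -> (forall y, W y -> g y != 0) -> Cnat k W g ->
  Cnat k W (fun z => (g z)^-1).
Proof.
move=> oW g0; elim: k => [|k IH] gC.
  by move=> y Wy; exact: (cvgV (g0 y Wy) (gC y Wy)).
have [gc gd] := gC; have C := IH (Cnat_pred gC).
split=> [y Wy|i]; first exact: (cvgV (g0 y Wy) (gc y Wy)).
have [gdi gci] := gd i.
split=> [y Wy|]; first exact: (derivableV (g0 y Wy) (gdi y Wy)).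
apply: (eq_Cnat oW _ (CnatZ (-1) oW (Cnat_mul oW (Cnat_mul oW C C) gci))) => y Wy.
rewrite /partial (deriveV (g0 y Wy) (gdi y Wy)) mulN1r -exprVn expr2 [RHS]mulNr.
by [].
Qed.

(** The cone [in_cone s i0] is the intersection of the half-spaces on which the
    linear forms [+- v_i - 2 s v_i0] are nonpositive; with [s = 1] and [s = -1]
    it is a closed cone around the half-line spanned by the basis vector [i0],
    respectively its opposite. [cone_fun] is a function of class C^m vanishing
    exactly on it. *)
Definition cone_dir (s : R) (i0 i : 'I_n) (b : bool) : 'rV[R]_n :=
  (-1) ^+ b *: delta_mx 0 i - (2 * s) *: delta_mx 0 i0.

Definition cone_fun (s : R) i0 m x z :=
  \sum_i \sum_(b : bool) ridge (cone_dir s i0 i b) x m.+1 z.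

Definition in_cone (s : R) i0 v := forall i, `|v 0 i| <= 2 * s * v 0 i0.

Lemma dotDl xi1 xi2 v : dot (xi1 + xi2) v = dot xi1 v + dot xi2 v.
Proof. by rewrite /dot -big_split; apply: eq_bigr => j _; rewrite mxE mulrDl. Qed.

Lemma dotZl (c : R) xi v : dot (c *: xi) v = c * dot xi v.
Proof. by rewrite /dot mulr_sumr; apply: eq_bigr => j _; rewrite mxE mulrA. Qed.

Lemma dot_delta_l i v : dot (delta_mx 0 i) v = v 0 i.
Proof.
rewrite /dot (bigD1 i) //= mxE !eqxx mul1r big1 ?addr0 // => j ji.
by rewrite mxE (negbTE ji) mul0r.
Qed.

Lemma dot_cone_dir s i0 i b v : dot (cone_dir s i0 i b) v = (-1) ^+ b * v 0 i - 2 * s * v 0 i0.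
Proof. by rewrite /cone_dir dotDl -scaleNr !dotZl !dot_delta_l mulNr. Qed.

Lemma pospow_ge0 k (t : R) : 0 <= pospow k t.
Proof. by rewrite exprn_ge0 // le_max lexx. Qed.

Lemma pospow_eq0 k (t : R) : (pospow k.+1 t == 0) = (t <= 0).
Proof.
rewrite /pospow expf_eq0 /=; have [t0|] := boolP (t <= 0); first by rewrite max_l // eqxx.
by rewrite -ltNge => t0; rewrite (max_r (ltW t0)) gt_eqF.
Qed.

Lemma cone_fun_ge0 s i0 m x z : 0 <= cone_fun s i0 m x z.
Proof. by do 2![apply: sumr_ge0 => ? _]; exact: pospow_ge0. Qed.

Lemma cone_fun_eq0 s i0 m x z : cone_fun s i0 m x z = 0 <-> in_cone s i0 (z - x).
Proof.
split=> [/eqP|zC].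
  rewrite psumr_eq0; last by move=> i _; apply: sumr_ge0 => b _; exact: pospow_ge0.
  move=> /allP H i; have := H i (mem_index_enum _).
  rewrite psumr_eq0; last by move=> b _; exact: pospow_ge0.
  move=> /allP Hb; rewrite ler_norml.
  have Hd b : dot (cone_dir s i0 i b) (z - x) <= 0.
    by rewrite -(pospow_eq0 m); exact: (Hb b (mem_index_enum _)).
  have := Hd true; have := Hd false; rewrite !dot_cone_dir expr0 expr1.
  by rewrite !subr_le0 mul1r mulN1r lerNl => -> ->.
rewrite /cone_fun big1 // => i _; rewrite big1 // => b _; apply/eqP.
rewrite pospow_eq0 dot_cone_dir subr_le0; apply: le_trans (zC i).
by case: b; rewrite ?expr1 ?mulN1r ?expr0 ?mul1r ?ler_norm // -normrN ler_norm.
Qed.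

Lemma in_cone_opp s i0 v : in_cone s i0 v -> in_cone (- s) i0 v -> v = 0.
Proof.
move=> H1 H2; apply/rowP => i; rewrite mxE; apply/eqP; rewrite -normr_le0.
have := lerD (H1 i) (H2 i).
by rewrite -mulrDl mulrN addrN mul0r => H; lra.
Qed.

Lemma Cnat_cone_fun s i0 m x W : open W -> Cnat m W (cone_fun s i0 m x).
Proof.
by move=> oW; do 2![apply: Cnat_sum => // ? _]; exact: Cnat_ridge.
Qed.

Lemma cone_fun_homog s i0 m x v (t : R) : 0 < t ->
  cone_fun s i0 m x (t *: v + x) = t ^+ m.+1 * cone_fun s i0 m x (v + x).
Proof.
move=> t0; rewrite /cone_fun mulr_sumr; apply: eq_bigr => i _.
rewrite mulr_sumr; apply: eq_bigr => b _.
rewrite /ridge !addrK dotZr /pospow -exprMn -{1}(mulr0 t) maxr_pMr //.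
exact: ltW.
Qed.

(** With [p] and [q] of class C^m, homogeneous of the same degree and vanishing
    exactly on the two cones, which only meet at the vertex, the quotient
    [p / (p + q)] does what is asked. *)
Lemma cutoff m i0 x : exists g, [/\ Cnat m [set~ x] g, homog x 0 g,
  forall z, in_cone 1 i0 (z - x) -> g z = 0 &
  forall z, z != x -> in_cone (-1) i0 (z - x) -> g z = 1].
Proof.
pose p := cone_fun 1 i0 m x; pose q := cone_fun (-1) i0 m x.
have pq z : z != x -> p z + q z != 0.
  move=> zx; apply: contra_neq zx => pq0.
  have /eqP := pq0; rewrite paddr_eq0 ?cone_fun_ge0 //.
  move=> /andP[/eqP/cone_fun_eq0 H1 /eqP/cone_fun_eq0 H2].
  by apply/eqP; rewrite -subr_eq0; apply/eqP; exact: in_cone_opp H1 H2.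
have oX : open [set~ x] by exact: open_neq.
exists (fun z => p z * (p z + q z)^-1); split.
- apply: Cnat_mul => //; first exact: Cnat_cone_fun.
  apply: (Cnat_inv oX) => [y /eqP|]; first exact: pq.
  have := Cnat_lin 1 oX (Cnat_cone_fun 1 i0 m x oX) (Cnat_cone_fun (-1) i0 m x oX).
  by apply: (eq_Cnat oX) => y _; rewrite mul1r.
- move=> t v t0 v0; rewrite expr0 mul1r /p /q !cone_fun_homog // -mulrDr invfM.
  by rewrite mulrACA mulfV ?mul1r // expf_neq0 // gt_eqF.
- by move=> z zC; rewrite /p (cone_fun_eq0 _ _ _ _ _).2 // mul0r.
- move=> z zx zC; rewrite /q (_ : cone_fun (-1) i0 m x z = 0); last exact/cone_fun_eq0.
  rewrite addr0 mulfV //; have := pq z zx.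
  by rewrite /q (_ : cone_fun (-1) i0 m x z = 0) ?addr0 //; exact/cone_fun_eq0.
Qed.

Lemma near_in_cone (b : bool) i0 x (t : R) : 0 < t ->
  \forall z \near ((-1) ^+ b * t) *: delta_mx 0 i0 + x, in_cone ((-1) ^+ b) i0 (z - x).
Proof.
move=> t0; set s : R := (-1) ^+ b; set z0 := _ + x.
(* The radius is such that t + t / 3 <= 2 * (t - t / 3). *)
apply: (@box_near _ _ _ _ (t / 3)); first by rewrite divr_gt0.
move=> z zz0 i.
have ss : s * s = 1 by rewrite /s -signr_addb addbb.
have zE j : (z - x) 0 j = (s * t) *+ (j == i0) + (z - z0) 0 j.
  by rewrite /z0 !mxE eqxx /= mulr_natr; ring.
have le j : `|(z - z0) 0 j| <= t / 3 by exact: le_trans (coord_le_norm _ _) zz0.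
have H0 : t - t / 3 <= s * (z - x) 0 i0.
  rewrite zE eqxx mulr1n mulrDr mulrA ss mul1r lerD2l lerNl -mulrN1 -mulrA.
  apply: le_trans (ler_norm _) _; rewrite normrM /s normr_sign mul1r mulrN1 normrN.
  exact: le.
apply: (@le_trans _ _ (t + t / 3)).
  rewrite zE; apply: le_trans (ler_normD _ _) _; apply: lerD => //.
  case: (i == i0); last by rewrite mulr0n normr0 (ltW t0).
  by rewrite mulr1n normrM /s normr_sign mul1r gtr0_norm.
rewrite -mulrA; lra.
Qed.

(** The key to locality arguments at a point: near the axis of one of the cones,
    [h] is 0, and near the axis of the other one it is [f]. *)
Lemma flat_split W m f x i0 : open W -> W x -> Cnat m W f -> flat m f x ->
  exists2 h, Cnat m W h & forall t : R, 0 < t ->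
    (\forall z \near t *: delta_mx 0 i0 + x, h z = 0) /\
    (\forall z \near (- t) *: delta_mx 0 i0 + x, h z = f z).
Proof.
move=> oW Wx fC ff; have [g [gC gh g0 g1]] := cutoff m i0 x.
exists (glue x (fun z => f z * g z)).
  by apply: (@glue_Cnat _ _ W m 0) => //; rewrite addn0.
move=> t t0; have Hneq (s : R) : s != 0 -> \forall z \near s *: delta_mx 0 i0 + x, z != x.
  move=> s0; have oX : open [set~ x] by exact: open_neq.
  have : (\forall z \near s *: delta_mx 0 i0 + x, [set~ x] z).
    apply: open_nbhs_nbhs; split=> // /eqP; rewrite -subr_eq0 addrK scaler_eq0 (negbTE s0) /=.
    by move=> /eqP/matrixP/(_ 0 i0)/eqP; rewrite !mxE !eqxx oner_eq0.
  by apply: filterS => z /eqP.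
split.
- have H := near_in_cone false i0 x t0; rewrite expr0 mul1r in H.
  apply: filterS H => z zC; have [->|zx] := eqVneq z x; first by rewrite glue_center.
  by rewrite glue_neq // g0 // mulr0.
- have H := near_in_cone true i0 x t0; rewrite expr1 mulN1r in H.
  have nt : - t != 0 by rewrite oppr_eq0 gt_eqF.
  apply: filterS2 H (Hneq _ nt) => z zC zx.
  by rewrite glue_neq // g1 // mulr1.
Qed.

End Cutoff.

(** * Sections in a chart and locality of sheaf morphisms *)

Section Manifold.
Context {R : realType} {n : nat} {X : manifold R n}.
Implicit Types (U V W : opens X) (r q : regularity) (c d : chart R n X).

Lemma Creg_cont r (W : set 'rV[R]_n) f : Creg r W f -> forall y, W y -> {for y, continuous f}.
Proof. by case: r => [k|] => [|/(_ 0%N)]; exact: Cnat_cont. Qed.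

Definition chart_opens c : opens X := Opens (@cdom_open _ _ _ c).

Lemma transition_continuous c d x : cdom c x -> cdom d x ->
  {for cmap d x, continuous (cmap c \o cinv d)}.
Proof.
move=> cx dx; apply: continuous_comp; first exact: cinv_cont.
by rewrite cmapK //; exact: cmap_cont.
Qed.

(** [F] is read in the chart [c]; its expression in the chart [d] is obtained by
    composing with the transition map, whose components are smooth. *)
Section Transition.
Variables (c d : chart R n X) (V : opens X) (k : nat) (F : 'rV[R]_n -> R).
Hypotheses (Ac : atlas c) (Ad : atlas d) (Vc : V `<=` cdom c).
Hypothesis FC : Cnat k (cmap c @` V) F.

Let oVc : open (cmap c @` V) := @chart_img_open_sub _ _ X c V Vc.
Let oVd : open (cmap d @` (V `&` cdom d)) := chart_img_open (c := d) (@oset_open _ V).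

Let maps_to y : (cmap d @` (V `&` cdom d)) y -> (cmap c @` V) ((cmap c \o cinv d) y).
Proof. by move=> [x [Vx dx] <-]; exists x; rewrite //= cmapK. Qed.

Let smooth j : Cnat k (cmap d @` (V `&` cdom d)) (fun y => (cmap c \o cinv d) y 0 j).
Proof.
apply: Cnat_sub (atlas_smooth Ad Ac j k) => _ [x [Vx dx] <-].
by exists x => //; split=> //; exact: Vc.
Qed.

Let cont y : (cmap d @` (V `&` cdom d)) y -> {for y, continuous (cmap c \o cinv d)}.
Proof. by move=> [x [Vx dx] <-]; apply: transition_continuous => //; exact: Vc. Qed.

Lemma Cnat_transition : Cnat k (cmap d @` (V `&` cdom d)) (F \o (cmap c \o cinv d)).
Proof. exact: (comp_Cnat oVd oVc maps_to smooth cont FC). Qed.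

Lemma flat_transition x : oset V x -> cdom d x -> flat k F (cmap c x) ->
  flat k (F \o (cmap c \o cinv d)) (cmap d x).
Proof.
move=> Vx dx fF; have Wx : (cmap d @` (V `&` cdom d)) (cmap d x) by exists x.
apply: (flat_comp oVd oVc Wx maps_to smooth cont FC).
by rewrite /= cmapK.
Qed.

End Transition.

Section ChartSection.
Variables (c : chart R n X) (V : opens X) (k : nat) (F : 'rV[R]_n -> R).
Hypotheses (Ac : atlas c) (Vc : V `<=` cdom c) (FC : Cnat k (cmap c @` V) F).

(** One chart suffices to check that a function supported in its domain is of
    class C^k. *)
Lemma chart_sec_subproof : patch (fun=> 0) V (F \o cmap c) \in is_C (Cfin k) V.
Proof. by apply: (@patch_C _ _ X (Cfin k) V V) => d Ad; exact: (Cnat_transition Ac Ad Vc FC). Qed.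

Definition chart_sec : C_sec (Cfin k) V := CSec chart_sec_subproof.

Lemma chart_secE x : oset V x -> chart_sec x = F (cmap c x).
Proof. by move=> Vx; rewrite /= /patch mem_set. Qed.

End ChartSection.

Lemma near_opens V x : oset V x -> \forall u \near x, oset V u.
Proof. by move=> Vx; apply: open_nbhs_nbhs; split=> //; exact: oset_open. Qed.

Section Locality.
Variables (q r : regularity) (U : opens X).
Variable T : hom_sec (Csheaf X q) (Csheaf X r) U.

Lemma hom_near (V1 V2 : opens X) (h1 : V1 `<=` U) (h2 : V2 `<=` U)
    (phi : C_sec q V1) (psi : C_sec q V2) x :
  oset V1 x -> oset V2 x -> (\forall u \near x, phi u = psi u) -> T V1 h1 phi x = T V2 h2 psi x.
Proof.
move=> V1x V2x e.
have oW : open ((V1 `&` V2) `&` interior [set u | phi u = psi u]).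
  by apply: openI; [apply: openI; exact: oset_open|exact: open_interior].
pose W := Opens oW.
have s1 : W `<=` V1 by move=> u [[]].
have s2 : W `<=` V2 by move=> u [[]].
have Wx : oset W x by split.
have E : C_res s1 phi = C_res s2 psi.
  by apply: C_secP => u Wu; rewrite !C_resE //; case: Wu => _ /interior_subset.
have sU : W `<=` U by exact: subset_trans s1 h1.
rewrite -(C_resE s1) // -(C_resE s2) //.
have E1 : T W sU (C_res s1 phi) = C_res s1 (T V1 h1 phi) := hmap_res T h1 sU s1 phi.
have E2 : T W sU (C_res s2 psi) = C_res s2 (T V2 h2 psi) := hmap_res T h2 sU s2 psi.
by rewrite -E1 -E2 E.
Qed.

Lemma hom_comb V (h : V `<=` U) (a : R) (phi psi : C_sec q V) x :
  T V h (a *: phi + psi) x = a * T V h phi x + T V h psi x.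
Proof. by have -> := hmap_linear T h a phi psi. Qed.

Lemma hom0 V (h : V `<=` U) x : T V h 0 x = 0.
Proof.
by have := hom_comb h (-1) 0 0 x; rewrite scaler0 addr0 mulN1r addNr.
Qed.

(** [G] is only required to be a combination of the [F i] pointwise on [V],
    which avoids evaluating sums of sections. *)
Lemma hom_sum V (h : V `<=` U) (I : Type) (s : seq I) (P : pred I) (C : I -> R)
    (F : I -> C_sec q V) (G : C_sec q V) x : oset V x ->
  (forall u, oset V u -> G u = \sum_(i <- s | P i) C i * F i u) ->
  T V h G x = \sum_(i <- s | P i) C i * T V h (F i) x.
Proof.
move=> Vx; elim: s G => [|i s IH] G GE.
  rewrite big_nil (_ : G = 0) ?hom0 //.
  by apply: C_secP => u Vu; rewrite GE // big_nil.
rewrite big_cons; case: ifP => Pi; last first.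
  by apply: IH => u Vu; rewrite GE // big_cons Pi.
rewrite -(IH ((- C i) *: F i + G)).
  by rewrite hom_comb mulNr addrA addrN add0r.
by move=> u Vu; rewrite C_linE GE // big_cons Pi mulNr addrA addNr add0r.
Qed.

Lemma hom_near0 V (h : V `<=` U) (phi : C_sec q V) x :
  oset V x -> (\forall u \near x, phi u = 0) -> T V h phi x = 0.
Proof. by move=> Vx phi0; rewrite -(hom0 h x); exact: hom_near. Qed.

Lemma hom_sec_continuous V (h : V `<=` U) (phi : C_sec q V) c x :
  atlas c -> oset V x -> cdom c x ->
  {for cmap c x, continuous (T V h phi \o cinv c)}.
Proof.
move=> Ac Vx cx; apply: (Creg_cont (C_sec_reg (T V h phi) Ac)).
by exists x.
Qed.

End Locality.

Section FlatVanish.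
Variables (m : nat) (r : regularity) (U : opens X).
Variable T : hom_sec (Csheaf X (Cfin m)) (Csheaf X r) U.

(** The product of [phi] by the cutoff function of [flat_split] is a section
    [psi] of class C^m which coincides with 0, respectively with [phi], near
    points arbitrarily close to [x]. By locality and continuity, [T psi x] is
    equal both to 0 and to [T phi x]. In dimension 0 there is no cone, but then
    [x] is isolated. *)
Lemma hom_flat V (h : V `<=` U) (phi : C_sec (Cfin m) V) c x :
  atlas c -> oset V x -> cdom c x -> flat m (phi \o cinv c) (cmap c x) -> T V h phi x = 0.
Proof.
move=> Ac Vx cx fphi.
pose V' := opensI V (chart_opens c).
have V'x : oset V' x by split.
have sV : V' `<=` V by move=> u [].
have sc : V' `<=` cdom c by move=> u [].
have sU : V' `<=` U by exact: subset_trans sV h.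
have -> : T V h phi x = T V' sU (C_res sV phi) x.
  by apply: hom_near => //; apply: filterS (near_opens V'x) => u V'u; rewrite C_resE.
case: (pickP 'I_n) => [i0 _|n0]; last first.
  apply: hom_near0 => //; apply: filterS (near_opens V'x) => u V'u; rewrite C_resE //.
  have -> : u = x.
    rewrite -(cmapK cx) -(cmapK (sc _ V'u)); congr (cinv c _).
    by apply/rowP => i; have := n0 i.
  by have := fphi [::] isT; rewrite /= cmapK.
pose W := cmap c @` V'.
have oW : open W by exact: chart_img_open_sub.
have Wy : W (cmap c x) by exists x.
have phiC : Cnat m W (phi \o cinv c) by exact: (C_sec_reg phi Ac).
have [f fC fP] := flat_split i0 oW Wy phiC fphi.
pose psi := chart_sec Ac sc fC.
have near_c u (P : 'rV[R]_n -> Prop) : oset V' u ->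
    (\forall z \near cmap c u, P z) -> \forall v \near u, P (cmap c v).
  by move=> V'u; exact: (cmap_cont (sc _ V'u)).
have G0 : (T V' sU psi \o cinv c) (cmap c x) = 0.
  apply: (eq_of_accumulation (G2 := cst 0)); [exact: hom_sec_continuous|exact: cst_continuous|].
  move=> e e0; have [t [t0 te]] := small_ray (delta_mx 0 i0) oW Wy e0.
  case: (fP t t0) => + _ Wz; have [u V'u uz] := Wz; rewrite -uz => fz.
  exists (cmap c u); first by rewrite uz.
  rewrite /= cmapK; last exact: (sc _ V'u).
  apply: hom_near0 => //.
  by apply: filterS2 (near_c _ _ V'u fz) (near_opens V'u) => v fv V'v; rewrite chart_secE.
have GF : (T V' sU psi \o cinv c) (cmap c x) = (T V' sU (C_res sV phi) \o cinv c) (cmap c x).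
  apply: eq_of_accumulation; [exact: hom_sec_continuous|exact: hom_sec_continuous|].
  move=> e e0; have [t [t0 te]] := small_ray (- delta_mx 0 i0) oW Wy e0.
  case: (fP t t0) => _; move: te; rewrite scalerN -scaleNr => te fz Wz.
  have [u V'u uz] := Wz; rewrite -uz in te fz.
  exists (cmap c u) => //.
  rewrite /= cmapK; last exact: (sc _ V'u).
  apply: hom_near => //.
  apply: filterS2 (near_c _ _ V'u fz) (near_opens V'u) => v fv V'v.
  by rewrite chart_secE // fv C_resE //= cmapK //; exact: (sc _ V'v).
by move: GF; rewrite G0 /= cmapK.
Qed.

End FlatVanish.
End Manifold.

(** * Local form of a sheaf morphism *)

Section Symbol.
Context {R : realType} {n : nat} {X : manifold R n}.
Implicit Types (U V W : opens X) (r q : regularity) (c d : chart R n X).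

Lemma CregM r (W : set 'rV[R]_n) f g : open W -> Creg r W f -> Creg r W g ->
  Creg r W (fun z => f z * g z).
Proof. by case: r => [k|] oW /= fC gC => [|k]; exact: Cnat_mul. Qed.

Lemma Creg_sum r (W : set 'rV[R]_n) (I : Type) (s : seq I) (P : pred I) F : open W ->
  (forall i, P i -> Creg r W (F i)) -> Creg r W (fun z => \sum_(i <- s | P i) F i z).
Proof.
case: r => [k|] oW /= FC => [|k]; first exact: Cnat_sum.
by apply: Cnat_sum => // i Pi; exact: FC.
Qed.

Lemma Creg_mono r (W : set 'rV[R]_n) x a : open W -> Creg r W (mono x a).
Proof. by case: r => [k|] oW => [|k]; exact: Cnat_mono. Qed.

Section Coefficients.
Variables (m : nat) (r : regularity) (U : opens X).
Variable T : hom_sec (Csheaf X (Cfin m)) (Csheaf X r) U.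

Definition chart_dom c : opens X := opensI U (chart_opens c).

Lemma chart_dom_sub c : chart_dom c `<=` U. Proof. by move=> u []. Qed.
Lemma chart_dom_cdom c : chart_dom c `<=` cdom c. Proof. by move=> u []. Qed.

Lemma open_chart_dom c : open (cmap c @` chart_dom c).
Proof. by apply: chart_img_open_sub; exact: chart_dom_cdom. Qed.

Section Chart.
Variables (c : chart R n X) (Ac : atlas c).

Definition mono_sec x a V (Vc : V `<=` cdom c) : C_sec (Cfin m) V :=
  chart_sec Ac Vc (Cnat_mono m x a (chart_img_open_sub Vc)).

Definition coef (a : 'I_n -> nat) (y : 'rV[R]_n) : R :=
  T (chart_dom c) (@chart_dom_sub c) (mono_sec y a (@chart_dom_cdom c)) (cinv c y) / afact a.

Lemma coefE a V (h : V `<=` U) (Vc : V `<=` cdom c) x : oset V x ->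
  T V h (mono_sec (cmap c x) a Vc) x = coef a (cmap c x) * afact a.
Proof.
move=> Vx; rewrite /coef divfK ?afact_neq0 // cmapK; last exact: Vc.
have Dx : oset (chart_dom c) x by split; [exact: h|exact: Vc].
apply: hom_near => //; apply: filterS (near_opens Vx) => u Vu; rewrite !chart_secE //.
by split; [exact: h|exact: Vc].
Qed.

(** In [coef a y] the function to which [T] is applied depends on [y]; expanding
    it by [mono_expand], only finitely many sections have to be considered. *)
Lemma Creg_coef a : (mdeg a <= m)%N -> Creg r (cmap c @` chart_dom c) (coef a).
Proof.
move=> am; have oD : open (cmap c @` chart_dom c) by exact: open_chart_dom.
pose C (b : mindex (n := n) m) : R := \prod_i ((-1) ^+ (a i - b i) *+ 'C(a i, b i)).
pose Tm (b : mindex (n := n) m) :=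
  T (chart_dom c) (@chart_dom_sub c) (mono_sec 0 (fun i => b i) (@chart_dom_cdom c)).
pose F (b : mindex (n := n) m) y :=
  C b / afact a * mono 0 (fun i => a i - b i)%N y * Tm b (cinv c y).
apply: (eq_Creg oD (f := fun y => \sum_b F b y)).
  move=> _ [x Dx <-]; rewrite /coef /F cmapK; last exact: chart_dom_cdom Dx.
  rewrite (hom_sum T _ (s := index_enum _) (P := predT)
    (F := fun b => mono_sec 0 (fun i => b i) (@chart_dom_cdom c))
    (C := fun b => C b * mono 0 (fun i => a i - b i)%N (cmap c x)) Dx).
    rewrite mulr_suml; apply: eq_bigr => b _.
    have alg (p q t s : R) : p * s * q * t = p * q * t * s by ring.
    exact: alg.
  move=> u Du; rewrite chart_secE // (mono_expand _ _ am).
  by apply: eq_bigr => b _; rewrite chart_secE.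
apply: Creg_sum => // b _; apply: CregM => //.
  apply: CregM => //; last exact: Creg_mono.
  exact: Creg_cst.
have -> : oset (chart_dom c) = chart_dom c `&` cdom c.
  by apply/esym/setIidl; exact: chart_dom_cdom.
exact: (C_sec_reg _ Ac).
Qed.

(** A polynomial of degree [k], seen as a section of class C^m: this is how jets
    of functions of class C^k are fed to an operator on C^m. *)
Definition taylor_sec k V (Vc : V `<=` cdom c) f y : C_sec (Cfin m) V :=
  chart_sec Ac Vc (Cnat_taylor_poly m k f y (chart_img_open_sub Vc)).

(** The value at [x] of the candidate operator of order [k], a function of the
    [k]-jet of [phi] in the chart [c]. *)
Definition jet_sum k (phi : X -> R) x : R :=
  \sum_(a : mindex (n := n) k | (mdeg (fun i => a i) <= k)%N)
    coef (fun i => a i) (cmap c x) * pderiv (fun i => a i) (phi \o cinv c) (cmap c x).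

Lemma hom_taylor_sec k V (h : V `<=` U) (Vc : V `<=` cdom c) (phi : X -> R) x : oset V x ->
  T V h (taylor_sec k Vc (phi \o cinv c) (cmap c x)) x = jet_sum k phi x.
Proof.
move=> Vx.
rewrite (hom_sum T _ (s := index_enum _)
  (P := fun a : mindex (n := n) k => (mdeg (fun i => a i) <= k)%N)
  (F := fun a => mono_sec (cmap c x) (fun i => a i) Vc)
  (C := fun a => pderiv (fun i => a i) (phi \o cinv c) (cmap c x) / afact (fun i => a i)) Vx).
  apply: eq_bigr => a _; rewrite coefE // [_ * afact _]mulrC mulrA divfK ?afact_neq0 //.
  exact: mulrC.
by move=> u Vu; rewrite chart_secE //; apply: eq_bigr => a _; rewrite chart_secE.
Qed.

Lemma flat_taylor k V (phi : C_sec (Cfin k) V) x : oset V x -> cdom c x ->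
  flat k (fun z => -1 * taylor_poly k (phi \o cinv c) (cmap c x) z + (phi \o cinv c) z) (cmap c x).
Proof.
move=> Vx cx; apply: (flat_taylor_poly (chart_img_open (@oset_open _ V)) _ (C_sec_reg phi Ac)).
by exists x.
Qed.

Lemma hom_taylor V (h : V `<=` U) (phi : C_sec (Cfin m) V) V' (h' : V' `<=` U)
    (V'c : V' `<=` cdom c) (V'V : V' `<=` V) x : oset V' x ->
  T V h phi x = T V' h' (taylor_sec m V'c (phi \o cinv c) (cmap c x)) x.
Proof.
move=> V'x; have Vx := V'V _ V'x; have cx := V'c _ V'x.
have -> : T V h phi x = T V' h' (C_res V'V phi) x.
  apply: hom_near => //; apply: filterS (near_opens V'x) => u V'u.
  by rewrite C_resE.
apply/eqP; rewrite -subr_eq0 addrC -mulN1r -hom_comb; apply/eqP.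
apply: (hom_flat _ _ Ac V'x cx).
apply: (eq_flat (chart_img_open_sub V'c) _ _ (flat_taylor phi Vx cx)); first by exists x.
by move=> _ [u V'u <-]; rewrite /comp (cmapK (V'c _ V'u)) C_linE chart_secE // C_resE.
Qed.

Lemma hom_jet_sum V (h : V `<=` U) (phi : C_sec (Cfin m) V) x : oset V x -> cdom c x ->
  T V h phi x = jet_sum m phi x.
Proof.
move=> Vx cx; pose V' := opensI V (chart_opens c).
have V'V : V' `<=` V by move=> u [].
have V'c : V' `<=` cdom c by move=> u [].
have V'x : oset V' x by split.
by rewrite (hom_taylor h phi (subset_trans V'V h) V'c V'V V'x) hom_taylor_sec.
Qed.

End Chart.
End Coefficients.
End Symbol.

(** * Bound on the order *)

Section Order.
Context {R : realType} {n : nat} {X : manifold R n}.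
Implicit Types (U V W : opens X) (r q : regularity) (c d : chart R n X).

Lemma dot_gt0 (xi : 'rV[R]_n) : xi != 0 -> 0 < dot xi xi.
Proof.
move=> xi0; rewrite lt0r sumr_ge0 ?andbT; last by move=> i _; rewrite -expr2 sqr_ge0.
apply: contra_neq xi0 => /eqP; rewrite psumr_eq0; last by move=> i _; rewrite -expr2 sqr_ge0.
move=> /allP H; apply/rowP => i; rewrite mxE.
by have := H i (mem_index_enum _); rewrite /= -expr2 sqrf_eq0 => /eqP.
Qed.

Lemma mono_comb_eq0 k (C : mindex (n := n) k -> R) (P : pred (mindex (n := n) k)) :
  (forall xi : 'rV[R]_n, \sum_(a | P a) C a * mono 0 (fun i => a i) xi = 0) ->
  forall b, P b -> C b = 0.
Proof.
move=> C0 b Pb; have := pderiv_sum_mono (0 : 'rV[R]_n) C Pb.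
have -> : (fun z : 'rV[R]_n => \sum_(a | P a) C a * mono 0 (fun i => a i) z) = (fun=> 0).
  by apply/funext.
rewrite pderivE wder0 => /esym/eqP.
by rewrite mulf_eq0 (negbTE (afact_neq0 _)) orbF => /eqP.
Qed.

Lemma mono_deg0 (x z : 'rV[R]_n) a : mdeg a = 0%N -> mono x a z = 1.
Proof.
move=> a0; rewrite /mono big1 // => i _.
by have := leq_mdeg a i; rewrite a0 leqn0 => /eqP ->.
Qed.

Lemma mono0_center a : mdeg a != 0%N -> mono (0 : 'rV[R]_n) a 0 = 0.
Proof.
move=> a0; rewrite mono_center; case: forallP => // H.
by case/negP: a0; rewrite /mdeg big1 // => i _; exact/eqP/H.
Qed.

Variables (m : nat) (r : regularity) (U : opens X).
Variable T : hom_sec (Csheaf X (Cfin m)) (Csheaf X r) U.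
Variables (c : chart R n X) (Ac : atlas c).

Let D := chart_dom U c.
Let sU : D `<=` U := @chart_dom_sub _ _ _ U c.
Let sc : D `<=` cdom c := @chart_dom_cdom _ _ _ U c.
Let oW : open (cmap c @` D) := @open_chart_dom _ _ _ U c.

(** [G] is the image under [T] of the ridge function of exponent [m + 1], read
    in the chart. It is 0 where [xi.(z - y) < 0], hence flat of order [s] at
    [y]; where [xi.(z - y) >= 0] it is [(xi.(z - y))^s * G2 z]. *)
Section Ridge.
Variables (xi : 'rV[R]_n) (x : X) (Dx : oset D x) (l s : nat).
Hypotheses (xi0 : xi != 0) (lsm : (l + s = m.+1)%N) (s0 : (0 < s)%N).
Hypothesis regs : forall (W : set 'rV[R]_n) f, @Creg R n r W f -> Cnat s W f.
Hypothesis higher : forall a, (l < mdeg a <= m)%N ->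
  forall z, (cmap c @` D) z -> coef T Ac a z = 0.

Let y := cmap c x.
Let Wy : (cmap c @` D) y. Proof. by exists x. Qed.
Let phi : C_sec (Cfin m) D := chart_sec Ac sc (Cnat_ridge m xi y oW).
Let G := T D sU phi \o cinv c.

Let GC : Cnat s (cmap c @` D) G.
Proof. by apply: regs; have := C_sec_reg (T D sU phi) Ac; rewrite (setIidl sc). Qed.

Let open_neg : open ((cmap c @` D) `&` [set z | dot xi (z - y) < 0]).
Proof.
have oN : open ((fun z => dot xi (z - y)) @^-1` [set t | t < 0]).
  apply: open_comp; last exact: open_lt.
  by move=> z _; exact: dot_continuous.
exact: openI oW oN.
Qed.

Let G_neg z : (cmap c @` D) z -> dot xi (z - y) < 0 -> G z = 0.
Proof.
move=> Wz zneg; have : \forall z' \near z, ((cmap c @` D) `&` [set z | dot xi (z - y) < 0]) z'.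
  by apply: open_nbhs_nbhs.
move: Wz => [u Du <-] nz; rewrite /G /= cmapK; last exact: sc Du.
apply: hom_near0 => //.
have := cmap_cont (sc Du) nz; apply: filterS2 (near_opens Du) => v Dv [_ vneg].
by rewrite chart_secE // /ridge pospow_neg // ltW.
Qed.

Let flatG : flat s G y.
Proof.
move=> w ws; apply: (eq_of_accumulation (G1 := wder w G) (G2 := cst 0)).
- by apply: (Cnat_cont (k := 0) _ Wy); apply: Cnat_wder; apply: Cnat_le GC.
- exact: cst_continuous.
- move=> e e0; have [t [t0 te Wz]] := small_ray (- xi) oW Wy e0.
  exists (t *: - xi + y) => //=.
  rewrite (eq_wder w open_neg (g := fun=> 0)) ?wder0 //.
    by move=> z [Wz' zneg]; exact: G_neg.
  split=> //=; rewrite addrK scalerN -scaleNr dotZr mulNr oppr_lt0 mulr_gt0 //.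
  exact: dot_gt0.
Qed.

Let G2 z := \sum_(a : mindex (n := n) m | (mdeg (fun i => a i) <= l)%N)
  coef T Ac (fun i => a i) z * ((m.+1 ^_ mdeg (fun i => a i))%:R * mono 0 (fun i => a i) xi)
    * dot xi (z - y) ^+ (l - mdeg (fun i => a i)).

Let lm : (l <= m)%N.
Proof. by rewrite -ltnS -lsm -addn1 leq_add2l. Qed.

Let G_pos z : (cmap c @` D) z -> 0 <= dot xi (z - y) -> G z = dot xi (z - y) ^+ s * G2 z.
Proof.
move=> Wz zpos; have [u Du uz] := Wz.
rewrite /G /= -uz cmapK; last exact: sc Du.
rewrite (hom_jet_sum T Ac sU phi Du (sc Du)) /jet_sum uz.
rewrite (bigID (fun a : mindex (n := n) m => (mdeg (fun i => a i) <= l)%N)) /=.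
rewrite [X in _ + X]big1 ?addr0; last first.
  move=> a /andP[am al]; rewrite higher ?mul0r //.
  by rewrite ltnNge al.
rewrite /G2 mulr_sumr; apply: eq_big => [a|a /andP[am al]].
  by rewrite andb_idl // => al; exact: leq_trans al lm.
rewrite (eq_pderiv (g := ridge xi y m.+1) _ oW); last exact: Wz; last first.
  by move=> _ [v Dv <-]; rewrite /= cmapK; [rewrite /patch mem_set|exact: sc Dv].
have E M : (M = mdeg (fun i => a i) + (m - mdeg (fun i => a i)))%N ->
    pderiv (fun i => a i) (ridge xi y M.+1) z = (M.+1 ^_ mdeg (fun i => a i))%:R
      * mono 0 (fun i => a i) xi * ridge xi y (m - mdeg (fun i => a i)).+1 z.
  by move=> ->; exact: pderiv_ridge.
rewrite (E m) ?subnKC // /ridge pospow_pos //.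
have shiftE p : (p <= l)%N -> ((m - p).+1 = s + (l - p))%N.
  by move=> pl; rewrite -subSn ?(leq_trans pl lm) // -lsm addnC addnBA.
rewrite shiftE //.
rewrite exprD.
have alg (p q1 q2 t1 t2 : R) : p * (q1 * q2 * (t1 * t2)) = t1 * (p * (q1 * q2) * t2) by ring.
exact: alg.
Qed.

Let G2_continuous : {for y, continuous G2}.
Proof.
apply: (Cnat_cont (k := 0) _ Wy); apply: Cnat_sum => // a al.
apply: (Cnat_mul (k := 0)) => //; first apply: (Cnat_mul (k := 0)) => //.
- move=> z Wz; apply: (Creg_cont (Creg_coef T Ac _) Wz); exact: leq_trans al lm.
- exact: (Cnat_cst 0).
- by move=> z _; exact: dot_pow_continuous.
Qed.

(** Along the ray y + t xi, flatness gives |G| <= e (t |xi|)^s for all e > 0,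
   whereas |G| = (t xi.xi)^s |G2|. *)
Let G2_center : G2 y = 0.
Proof.
apply/eqP; rewrite -normr_le0; apply/ler_addgt0Pr => e e0; rewrite add0r.
have xixi := dot_gt0 xi0.
pose C := (`|xi| / dot xi xi) ^+ s.
have C0 : 0 <= C by rewrite exprn_ge0 // divr_ge0 // ltW.
have C10 : 0 < C + 1 by rewrite ltr_wpDl.
have e20 : 0 < e / 2 by rewrite divr_gt0.
have e'0 : 0 < e / 2 / (C + 1) by rewrite divr_gt0.
have [p p0 pP] := near_box (filterI (near_le_of_continuous G2_continuous e20)
  (flat_small oW Wy GC flatG e'0)).
have [t [t0 zp Wz]] := small_ray xi oW Wy p0.
move: zp Wz; set z := t *: xi + y => zp Wz.
have [h1 h2] := pP z zp.
have zy : z - y = t *: xi by rewrite addrK.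
have dz : dot xi (z - y) = t * dot xi xi by rewrite zy dotZr.
have dpos : 0 < dot xi (z - y) by rewrite dz mulr_gt0.
have G2z : `|G2 z| <= e / 2.
  move: h2; rewrite (G_pos Wz (ltW dpos)) normrM normrX (gtr0_norm dpos) dz.
  rewrite zy normrZ (gtr0_norm t0).
  rewrite exprMn -ler_pdivlMl; last by rewrite mulr_gt0 // exprn_gt0.
  move/le_trans; apply.
  rewrite [X in X <= _](_ : _ = e / 2 / (C + 1) * C).
    rewrite mulrAC ler_pdivrMr //; apply: ler_wpM2l; first exact: ltW.
    by rewrite lerDl ler01.
  move: (C + 1) (gt_eqF C10) => C1 C10'; rewrite /C !exprMn exprVn.
  have ts : t ^+ s != 0 by rewrite expf_neq0 // gt_eqF.
  have ds : dot xi xi ^+ s != 0 by rewrite expf_neq0 // gt_eqF.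
  by field; rewrite ts ds C10'.
rewrite (_ : G2 y = G2 z - (G2 z - G2 y)); last by rewrite subKr.
by rewrite (splitr e); apply: le_trans (ler_normB _ _) (lerD G2z h1).
Qed.

Lemma symbol_eq0 :
  \sum_(a : mindex (n := n) m | mdeg (fun i => a i) == l)
    coef T Ac (fun i => a i) (cmap c x) * mono 0 (fun i => a i) xi = 0.
Proof.
have := G2_center; rewrite /G2 subrr.
rewrite (bigID (fun a : mindex (n := n) m => mdeg (fun i => a i) == l)) /=.
rewrite [X in _ + X]big1 ?addr0; last first.
  move=> a /andP[al anl]; rewrite (_ : dot xi 0 = 0); last first.
    by rewrite /dot big1 // => i _; rewrite mxE mulr0.
  by rewrite expr0n subn_eq0 leqNgt ltn_neqAle anl al /= mulr0.
move=> H; have K0 : (m.+1 ^_ l)%:R != 0 :> R.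
  by rewrite pnatr_eq0 -lt0n ffact_gt0 (leq_trans lm).
apply: (mulfI K0); rewrite mulr0 -[RHS]H mulr_sumr; apply: eq_big => [a|a /eqP al].
  by case: eqVneq => [->|]; rewrite ?leqnn ?andbF.
by rewrite al subnn expr0 mulr1 mulrCA.
Qed.

End Ridge.

(** Descending induction on [mdeg a], from [m] down to [k0]. The symbol is only
    known to vanish for [xi != 0]; at [xi = 0] this is clear in positive degree,
    and in degree 0 the symbol is constant, so that one nonzero [xi] suffices,
    whence the assumption on the dimension. *)
Lemma coef_eq0 k0 : (k0 = 0%N -> (0 < n)%N) ->
  (forall l, (k0 <= l <= m)%N ->
    forall (W : set 'rV[R]_n) f, @Creg R n r W f -> Cnat (m.+1 - l) W f) ->
  forall a, (k0 <= mdeg a <= m)%N -> forall z, (cmap c @` D) z -> coef T Ac a z = 0.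
Proof.
move=> n0 reg a akm; have [d] := ubnP (m - mdeg a); elim: d a akm => // d IH a akm ad z Wz.
have [x Dx xz] := Wz.
have am : (mdeg a <= m)%N by case/andP: akm.
have S xi : xi != 0 -> \sum_(b : mindex (n := n) m | mdeg (fun i => b i) == mdeg a)
    coef T Ac (fun i => b i) (cmap c x) * mono 0 (fun i => b i) xi = 0.
  move=> xi0; apply: (@symbol_eq0 xi x Dx (mdeg a) (m.+1 - mdeg a)) => //.
  - by rewrite subnKC // leqW.
  - by rewrite subn_gt0 ltnS.
  - exact: reg.
  - move=> b /andP[ab bm]; apply: IH.
      by rewrite bm (leq_trans _ (ltnW ab)) //; case/andP: akm.
    rewrite -ltnS; apply: leq_trans ad; rewrite ltnS.
    by apply: ltn_sub2l => //; exact: leq_trans ab bm.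
have := @mono_comb_eq0 m (fun b => coef T Ac (fun i => b i) (cmap c x))
  (fun b => mdeg (fun i => b i) == mdeg a) _ (mindex_of m a).
rewrite mindex_ofE // xz => /(_ _ (eqxx _)); apply => xi.
rewrite -xz; have [->|] := eqVneq xi 0; last exact: S.
have [a0|a0] := eqVneq (mdeg a) 0%N; last first.
  by rewrite big1 // => b /eqP ba; rewrite mono0_center ?mulr0 // ba.
have npos : (0 < n)%N by apply: n0; move: akm; rewrite a0 leqn0 => /andP[/eqP].
have d0 : delta_mx 0 (Ordinal npos) != 0 :> 'rV[R]_n.
  by apply/eqP => /matrixP/(_ 0 (Ordinal npos))/eqP; rewrite !mxE !eqxx oner_eq0.
rewrite -[RHS](S _ d0); apply: eq_bigr => b /eqP ba; congr (_ * _).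
by rewrite !mono_deg0 // ba.
Qed.

End Order.

(** * Extension of the local formulas and the isomorphism *)

Section SheafIso.
Context {R : realType} {X : topologicalType}.

Lemma sheaf_iso_of_bij (F G : sheaf R X) (f : sheaf_hom F G) :
  (forall U (s s' : F U), f U s = f U s' -> s = s') ->
  (forall U (t : G U), exists s, f U s = t) -> sheaf_iso f.
Proof.
move=> inj surj; pose g U (t : G U) : F U := projT1 (cid (surj U t)).
have gK U t : f U (g U t) = t by exact: projT2 (cid (surj U t)).
have glin U : linear (@g U).
  by move=> a t t'; apply: inj; rewrite shom_linear !gK.
have gres (U V : opens X) (h : V `<=` U) (t : G U) : g V (res h t) = res h (g U t).
  by apply: inj; rewrite shom_res !gK.
exists (SheafHom glin gres); split=> U t /=; last exact: gK.
by apply: inj; rewrite gK.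
Qed.

Lemma zero_hom_iso (G : sheaf R X) : (forall U (t : G U), t = 0) -> sheaf_iso (zero_hom G).
Proof.
move=> G0; apply: sheaf_iso_of_bij => [U s s' _|U t]; first by apply/rowP => -[].
by exists 0; rewrite [RHS]G0.
Qed.

End SheafIso.

Section Main.
Context {R : realType} {n : nat} {X : manifold R n}.
Implicit Types (U V W : opens X) (r q : regularity) (c d : chart R n X).

Lemma hom_eq0 m r U (T : Defs.Hom (Csheaf X (Cfin m)) (Csheaf X r) U) : (0 < n)%N ->
  (forall (W : set 'rV[R]_n) f, Creg r W f -> Cnat m.+1 W f) -> T = 0.
Proof.
move=> n0 reg; apply: hom_secP => V h phi; apply: C_secP => x Vx.
have [c Ac cx] := atlas_cover x.
rewrite (hom_jet_sum T Ac h phi Vx cx) /jet_sum big1 // => a am.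
rewrite (@coef_eq0 _ _ _ m r U T c Ac 0) ?mul0r //.
  by move=> l _ W f /reg; apply: Cnat_le; exact: leq_subr.
by exists x => //; split=> //; exact: h.
Qed.

Section Fin.
Variables (k m r : nat) (krm : (k + r)%N = m) (U : opens X).
Variable T : hom_sec (Csheaf X (Cfin m)) (Csheaf X (Cfin r)) U.

Let km : (k <= m)%N. Proof. by rewrite -krm leq_addr. Qed.

Lemma mindex_of_widen (b : mindex (n := n) k) :
  (fun i => mindex_of m (fun i => b i) i : nat) = (fun i => b i).
Proof.
by apply/funext => i; rewrite ffunE inordK // (leq_trans (ltn_ord (b i))).
Qed.

Lemma mindex_of_id (b : mindex (n := n) k) : mindex_of k (fun i => b i) = b.
Proof. by apply/ffunP => i; rewrite ffunE inord_val. Qed.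

(** The coefficients of degree greater than [k] vanish, and the others are
    reindexed from the multi-indices bounded by [m] to those bounded by [k]. *)
Lemma jet_sum_order c (Ac : atlas c) (phi : X -> R) x : oset U x -> cdom c x ->
  jet_sum T Ac m phi x = jet_sum T Ac k phi x.
Proof.
move=> Ux cx; pose F a := coef T Ac a (cmap c x) * pderiv a (phi \o cinv c) (cmap c x).
have coef0 a : (k < mdeg a <= m)%N -> coef T Ac a (cmap c x) = 0.
  move=> akm; apply: (@coef_eq0 _ _ _ m (Cfin r) U T c Ac k.+1) => //.
    move=> l /andP[kl _] W f; apply: Cnat_le.
    by rewrite -krm leq_subLR -addSn leq_add2r.
  by exists x.
rewrite /jet_sum (bigID (fun a : mindex (n := n) m => (mdeg (fun i => a i) <= k)%N)) /=.
rewrite [X in _ + X]big1 ?addr0; last first.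
  by move=> a /andP[am ak]; rewrite coef0 ?mul0r // ltnNge ak.
rewrite (reindex_onto (fun b : mindex k => mindex_of m (fun i => b i))
  (fun a : mindex m => mindex_of k (fun i => a i))) /=; last first.
  move=> a /andP[_ ak]; apply/ffunP => i; apply/val_inj.
  have E1 := congr1 (fun F => F i) (mindex_of_widen (mindex_of k (fun i => a i))).
  exact: etrans E1 (congr1 (fun F => F i) (mindex_ofE ak)).
apply: eq_big => [b|b _]; rewrite !mindex_of_widen // mindex_of_id eqxx andbT.
by rewrite andb_idl // => /leq_trans; apply.
Qed.

Lemma jet_sum_eq c (Ac : atlas c) V (phi psi : X -> R) x : oset V x -> cdom c x ->
  (forall u, oset V u -> phi u = psi u) -> jet_sum T Ac k phi x = jet_sum T Ac k psi x.
Proof.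
move=> Vx cx e; apply: eq_bigr => a _; congr (_ * _).
apply: (eq_pderiv _ (chart_img_open (c := c) (@oset_open _ V))); last by exists x.
by move=> _ [u [Vu cu] <-]; rewrite /= cmapK // e.
Qed.

(** On functions of class C^m the two sides are the value of [T]. The Taylor
    polynomial [p] of [phi] in the chart [c] is such a function, with the same
    [k]-jet as [phi] at [x] in the chart [c], hence also in the chart [d] by
    [flat_transition]. *)
Lemma jet_sum_chart c d (Ac : atlas c) (Ad : atlas d) V (h : V `<=` U)
    (phi : C_sec (Cfin k) V) x :
  oset V x -> cdom c x -> cdom d x -> jet_sum T Ac k phi x = jet_sum T Ad k phi x.
Proof.
move=> Vx cx dx; pose V' := opensI V (chart_opens c).
have V'V : V' `<=` V by move=> u [].
have V'c : V' `<=` cdom c by move=> u [].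
have V'x : oset V' x by split.
have h' := subset_trans V'V h.
rewrite -(hom_taylor_sec T Ac k h' V'c phi V'x); set p := taylor_sec _ _ _ _ _ _.
rewrite (hom_jet_sum T Ad h' p V'x dx) jet_sum_order //; last exact: h'.
apply: eq_bigr => a ak; congr (_ * _).
have oVd := chart_img_open (c := d) (@oset_open _ V').
have Wx : (cmap d @` (V' `&` cdom d)) (cmap d x) by exists x.
have pC : Cnat k (cmap d @` (V' `&` cdom d)) (p \o cinv d).
  exact: Cnat_le km (C_sec_reg p Ad).
have phiC : Cnat k (cmap d @` (V' `&` cdom d)) (phi \o cinv d).
  by apply: Cnat_sub (C_sec_reg phi Ad); apply: image_subset; exact: setSI.
apply: (eq_pderiv_flat oVd Wx pC phiC ak).
have oV' := chart_img_open_sub V'c.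
have FC : Cnat k (cmap c @` V')
    (fun z => -1 * taylor_poly k (phi \o cinv c) (cmap c x) z + (phi \o cinv c) z).
  by apply: Cnat_lin => //; [exact: Cnat_taylor_poly|exact: (C_sec_reg phi Ac)].
apply: (eq_flat oVd Wx _ (flat_transition Ac Ad V'c FC V'x dx (flat_taylor Ac phi Vx cx))).
move=> _ [u [V'u du] <-].
by rewrite /comp (cmapK du) (cmapK (V'c _ V'u)) /p chart_secE.
Qed.

Lemma pderiv_comb (W : set 'rV[R]_n) a (b : R) f g y : open W -> W y ->
  Cnat (mdeg a) W f -> Cnat (mdeg a) W g ->
  pderiv a (fun z => b * f z + g z) y = b * pderiv a f y + pderiv a g y.
Proof.
by move=> oW Wy; rewrite !pderivE -size_word => fC gC; exact: (wder_lin b oW fC gC Wy).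
Qed.

Let chart_at (x : X) : chart R n X := s2val (cid2 (atlas_cover x)).
Let chart_atA x : atlas (chart_at x) := s2valP (cid2 (atlas_cover x)).
Let chart_at_dom x : cdom (chart_at x) x := s2valP' (cid2 (atlas_cover x)).

(** The extension of [T] to functions of class C^k. Since [jet_sum] does not
    depend on the chart, an arbitrary choice of a chart around each point is
    harmless. *)
Definition ext_val (phi : X -> R) (x : X) : R := jet_sum T (chart_atA x) k phi x.

Lemma ext_valE c (Ac : atlas c) V (h : V `<=` U) (phi : C_sec (Cfin k) V) x :
  oset V x -> cdom c x -> ext_val phi x = jet_sum T Ac k phi x.
Proof. by move=> Vx cx; apply: (jet_sum_chart _ _ h) => //; exact: chart_at_dom. Qed.

Lemma ext_map_subproof V (h : V `<=` U) (phi : C_sec (Cfin k) V) :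
  patch (fun=> 0) V (ext_val phi) \in is_C (Cfin 0) V.
Proof.
apply: (@patch_C _ _ X (Cfin 0) V V) => c Ac.
have oV := chart_img_open (c := c) (@oset_open _ V).
pose F z := \sum_(a : mindex (n := n) k | (mdeg (fun i => a i) <= k)%N)
    coef T Ac (fun i => a i) z * pderiv (fun i => a i) (phi \o cinv c) z.
apply: (eq_Cnat (k := 0) (f := F) oV).
  by move=> _ [x [Vx cx] <-]; rewrite /= cmapK // (ext_valE Ac h).
apply: Cnat_sum => // a ak; apply: (Cnat_mul (k := 0)) => //.
  move=> _ [x [Vx cx] <-]; apply: (Creg_cont (Creg_coef T Ac (leq_trans ak km))).
  by exists x => //; split=> //; exact: h.
by apply: Cnat_pderiv; rewrite add0n; apply: Cnat_le ak (C_sec_reg phi Ac).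
Qed.

Definition ext_map V (h : V `<=` U) (phi : C_sec (Cfin k) V) : C_sec (Cfin 0) V :=
  CSec (ext_map_subproof h phi).

Lemma ext_mapE c (Ac : atlas c) V (h : V `<=` U) (phi : C_sec (Cfin k) V) x :
  oset V x -> cdom c x -> ext_map h phi x = jet_sum T Ac k phi x.
Proof. by move=> Vx cx; rewrite /= /patch mem_set // (ext_valE Ac h). Qed.

Lemma ext_map_linear V (h : V `<=` U) : linear (@ext_map V h).
Proof.
move=> b phi psi; apply: C_secP => x Vx.
have [c Ac cx] := atlas_cover x.
rewrite C_linE !(ext_mapE Ac) // mulr_sumr -big_split /=; apply: eq_bigr => a ak.
have oV := chart_img_open (c := c) (@oset_open _ V).
have Wx : (cmap c @` (V `&` cdom c)) (cmap c x) by exists x.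
rewrite mulrCA -mulrDr; congr (_ * _).
apply: (pderiv_comb b oV Wx); first exact: Cnat_le ak (C_sec_reg phi Ac).
exact: Cnat_le ak (C_sec_reg psi Ac).
Qed.

Lemma ext_map_res V W (hV : V `<=` U) (hW : W `<=` U) (hWV : W `<=` V)
    (phi : C_sec (Cfin k) V) :
  ext_map hW (C_res hWV phi) = C_res hWV (ext_map hV phi).
Proof.
apply: C_secP => x Wx; have [c Ac cx] := atlas_cover x.
rewrite C_resE // !(ext_mapE Ac) //; last exact: hWV.
by apply: (jet_sum_eq _ Wx cx) => u Wu; rewrite C_resE.
Qed.

Definition ext_hom : hom_sec (Csheaf X (Cfin k)) (Csheaf X (Cfin 0)) U :=
  @HomSec R X (Csheaf X (Cfin k)) (Csheaf X (Cfin 0)) U ext_map ext_map_linear ext_map_res.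

Lemma ext_hom_diffop : ext_hom \in is_diffop (k := k) (Cfin r) (U := U).
Proof.
apply/asboolP => c Ac x Ux cx.
exists (chart_dom U c), (@chart_dom_sub _ _ _ U c); split; [by []|exact: chart_dom_cdom|].
(* The coefficients of degree greater than k do not enter the formula, but have
   to be of class C^r as well. *)
exists (fun (a : mindex (n := n) k) z =>
    if (mdeg (fun i => a i) <= k)%N then coef T Ac (fun i => a i) z else 0) => [a|V hV phi y Vy].
  case ak: (mdeg (fun i => a i) <= k)%N; first by apply: Creg_coef; exact: leq_trans ak km.
  by apply: Creg_cst; exact: open_chart_dom.
rewrite (ext_mapE Ac) //; last by case: (hV _ Vy).
by apply: eq_bigr => a ->.
Qed.

End Fin.
Section Action.
Variables (m r : nat) (rm : (r <= m)%N).
Let k := (m - r)%N.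
Let krm : (k + r <= m)%N := eq_leq (subnK rm).

Lemma action_surj U (T : hom_sec (Csheaf X (Cfin m)) (Csheaf X (Cfin r)) U) :
  exists P, action X krm U P = T.
Proof.
have kr : (k + r)%N = m := subnK rm.
exists (DSec (ext_hom_diffop kr T)).
apply: hom_secP => V h phi; apply: C_secP => x Vx.
have [c Ac cx] := atlas_cover x.
rewrite (hom_jet_sum T Ac h phi Vx cx) (jet_sum_order kr) //; last exact: h.
exact: (ext_mapE kr T Ac h (C_incl krm phi) Vx cx).
Qed.

(** The action on C^m determines [P] on the larger sheaf C^k: at a given point,
    [phi] may be replaced by its Taylor polynomial of degree [k]. *)
Lemma diffop_action U (P : D_sec (X := X) k (Cfin r) U) V (h : V `<=` U)
    (phi : C_sec (Cfin k) V) c (Ac : atlas c) x (V' : opens X) (h' : V' `<=` U)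
    (V'c : V' `<=` cdom c) :
  V' `<=` V -> oset V' x ->
  dop P V h phi x = action X krm U P V' h' (taylor_sec m Ac k V'c (phi \o cinv c) (cmap c x)) x.
Proof.
move=> V'V V'x; rewrite (hom_taylor (dop P) Ac h phi h' V'c V'V V'x) /=.
by congr (cfun (P V' h' _) x); apply: C_secP => u V'u.
Qed.

Lemma action_inj U (P Q : D_sec (X := X) k (Cfin r) U) :
  action X krm U P = action X krm U Q -> P = Q.
Proof.
move=> PQ; apply: D_secP; apply: hom_secP => V h phi; apply: C_secP => x Vx.
have [c Ac cx] := atlas_cover x; pose V' := opensI V (chart_opens c).
have V'V : V' `<=` V by move=> u [].
have V'c : V' `<=` cdom c by move=> u [].
have V'x : oset V' x by split.
have h' := subset_trans V'V h.
by rewrite !(diffop_action _ h phi Ac h' V'c V'V V'x) PQ.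
Qed.

Lemma action_iso : sheaf_iso (action X krm).
Proof. by apply: sheaf_iso_of_bij => U; [exact: action_inj|exact: action_surj]. Qed.

End Action.
End Main.

(* In dimension 0 every function is smooth, so that Hom(C^m, C^r) is C^0 and
   not 0 when m - r < 0: that case is excluded. *)
Theorem theorem1p2 (R : realType) (n : nat) (X : manifold R n)
    (m : nat) (r : regularity) :
  (order_sub m r = None -> (0 < n)%N) ->
  sheaf_iso (natural_morphism X m r).
Proof.
case: r => [r|] n0; last first.
  apply: zero_hom_iso => U T; apply: hom_eq0; first exact: n0.
  by move=> W f; exact.
(* The boolean is generalized together with its case analysis, on which the
   source of the natural morphism depends. *)
suff iso b (H : alt_spec (r <= m)%N (r <= m)%N b) :
    ((if b then Some (m - r)%N else None) = None -> (0 < n)%N) ->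
    sheaf_iso (match H in alt_spec _ _ b return
      sheaf_hom (Dsheaf X (if b then Some (m - r)%N else None) (Cfin r))
        (Defs.Hom (Csheaf X (Cfin m)) (Csheaf X (Cfin r))) with
    | AltTrue rm => action X (eq_leq (subnK rm))
    | AltFalse _ => zero_hom _
    end) by exact: iso (boolP _) n0.
case: H => [rm _|rm {}n0]; first exact: action_iso.
apply: zero_hom_iso => U T; apply: hom_eq0; first exact: n0.
by move=> W f; apply: Cnat_le; rewrite ltnNge.
Qed.
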